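(* Let $V$ be a $K$-analytic annulus, let $(X,Y)$ be a Laurent pair for $V$, and let $f\in\mathcal O^\circ_V(V)$ be a nonzero bounded analytic function on $V$. Then there exist a monic polynomial $P\in R[Y]$ and a unit $u$ of $\mathcal O^\circ_V(V)$ such that $$Y^{\alpha}f(X,Y)=\pi^{\eta_Y(f)}P(Y)\,u(X,Y),$$ where $\alpha=v_X(f)$ if $V$ is an open annulus and $\alpha=\nu_X(f)$ otherwise.
   Context: $K$ is a field complete with respect to a nontrivial discrete valuation $\mathrm{ord}_\pi$ (normalized by $\mathrm{ord}_\pi(\pi)=1$), $R$ its valuation ring, $\pi$ a uniformizer; $R\{\cdot\}$ denotes convergent power series (coefficients tending to $0$). An open (resp. semi-open, resp. closed) annulus $V$ over $K$ of modulus $e\ge1$ is a $K$-analytic space isomorphic to the one associated with $\mathrm{Spf}(A)$, where $A\cong R[[X,Y]]/(XY-\pi^e)$ (resp. $R\{X\}[[Y]]/(XY-\pi^e)$, resp. $R\{X,Y\}/(XY-\pi^e)$), i.e. the locus $XY=\pi^e$ in $\{|X|<1,|Y|<1\}$ (resp. $\{|X|\le1,|Y|<1\}$, resp. $\{|X|\le1,|Y|\le1\}$). Given such a presentation, the pair $(X,Y)$ is called a Laurent pair, and $A=\mathcal O^\circ_V(V)$ is the ring of analytic functions on $V$ bounded by $1$. Substituting $Y=\pi^eX^{-1}$, write $f=\sum_{i\in\mathbb Z}a_iX^i$. Put $\eta_X(f)=\min_i\mathrm{ord}_\pi(a_i)$, $v_X(f)=\min\{i:\mathrm{ord}_\pi(a_i)=\eta_X(f)\}$,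 and, for $V$ closed or semi-open, $\nu_X(f)=\max\{i:\mathrm{ord}_\pi(a_i)=\eta_X(f)\}$. Similarly, substituting $X=\pi^eY^{-1}$ and writing $f=\sum_{i\in\mathbb Z}b_iY^i$, put $\eta_Y(f)=\min_i\mathrm{ord}_\pi(b_i)$. The integer $\alpha$ may be negative; the equality is an equality of analytic functions on $V$, where $Y$ is invertible. *)

(* Defs.v *)
From HB Require Import structures.
From mathcomp Require Import all_boot all_order all_algebra.
From mathcomp Require Import mathcomp_extra boolp classical_sets functions.
From mathcomp Require Import constructive_ereal.

Set Implicit Arguments.
Unset Strict Implicit.
Unset Printing Implicit Defensive.

Import Order.TTheory GRing.Theory Num.Theory.

Local Open Scope ring_scope.

(* The value -oo is excluded by valM applied to 0. *)
Record discrete_valuation (K : fieldType) := DiscreteValuation {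
  val_of :> K -> \bar int;
  val_pinfty : forall x, (val_of x == +oo%E) = (x == 0);
  valM : forall x y, val_of (x * y) = (val_of x + val_of y)%E;
  valD : forall x y, (Order.min (val_of x) (val_of y) <= val_of (x + y))%O
}.

Section Valuation.
Variables (K : fieldType) (ord : discrete_valuation K).

Definition ord_converges (s : nat -> K) (l : K) : Prop :=
  forall N : int, exists n0 : nat, forall n : nat,
    (n0 <= n)%N -> (N%:E <= ord (s n - l)%R)%E.

Definition ord_cauchy (s : nat -> K) : Prop :=
  forall N : int, exists n0 : nat, forall m n : nat,
    (n0 <= m)%N -> (n0 <= n)%N -> (N%:E <= ord (s m - s n)%R)%E.

Definition ord_complete : Prop :=
  forall s : nat -> K, ord_cauchy s -> exists l : K, ord_converges s l.

(* 0 when the series does not converge. *)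
Definition ord_sum (s : nat -> K) : K :=
  xget 0 [set l | ord_converges (fun n => \sum_(k < n) s k) l]%classic.

Lemma ord_ninfty x : ord x != -oo%E.
Proof.
apply/eqP => ordx; have := valM ord x 0.
have /eqP -> : ord 0 == +oo%E by rewrite val_pinfty.
by rewrite mulr0 ordx; have /eqP -> : ord 0 == +oo%E by rewrite val_pinfty.
Qed.

Lemma ord_pinfty0 : ord 0 = +oo%E.
Proof. by apply/eqP; rewrite val_pinfty. Qed.

Lemma ord_fin x : x != 0 -> exists n : int, ord x = n%:E.
Proof.
rewrite -(val_pinfty ord) => x0; move: x0 (ord_ninfty x).
by case: (ord x) => [n| |] // _ _; exists n.
Qed.

Lemma ord1 : ord 1 = 0%:E.
Proof.
have [n En] := ord_fin (oner_neq0 K).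
have := valM ord 1 1; rewrite mulr1 En => -[] /eqP.
by rewrite -subr_eq0 opprD addNKr oppr_eq0 => /eqP ->.
Qed.

Lemma ordN1 : ord (-1) = 0%:E.
Proof.
have n0 : -1 != 0 :> K by rewrite oppr_eq0 oner_neq0.
have [n En] := ord_fin n0.
have := valM ord (-1) (-1); rewrite mulrNN mulr1 ord1 En => -[] /esym/eqP.
by rewrite -mulr2n mulrn_eq0 /= => /eqP ->.
Qed.

Lemma ordN x : ord (- x) = ord x.
Proof. by rewrite -mulN1r valM ordN1 add0e. Qed.

Definition vring_pred : {pred K} := fun x => (0%:E <= ord x)%E.

Lemma vring_pred_subring : subring_closed vring_pred.
Proof.
split=> [|x y|x y]; rewrite /in_mem /= /vring_pred.
- by rewrite ord1.
- move=> x0 y0; apply: le_trans (valD ord x (- y)).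
  by rewrite le_min x0 ordN.
- by move=> x0 y0; rewrite valM adde_ge0.
Qed.

HB.instance Definition _ :=
  GRing.isSubringClosed.Build K vring_pred vring_pred_subring.

Record vring := VRing { vring_val :> K; _ : vring_val \in vring_pred }.

HB.instance Definition _ := [isSub for vring_val].
HB.instance Definition _ := [Choice of vring by <:].
HB.instance Definition _ := [SubChoice_isSubComNzRing of vring by <:].

Lemma vring_valD (x y : vring) : vring_val (x + y) = vring_val x + vring_val y.
Proof. exact: (raddfD \val). Qed.

Lemma vring_valN (x : vring) : vring_val (- x) = - vring_val x.
Proof. exact: (raddfN \val). Qed.

Lemma vring_valM (x y : vring) : vring_val (x * y) = vring_val x * vring_val y.
Proof. exact: (rmorphM \val). Qed.

End Valuation.

(* One-variable formal power series; two-variable ones are obtained by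
   iteration, X being the inner variable and Y the outer one. *)
Definition fps (R : Type) : Type := nat -> R.

Section FPS.
Variable R : comNzRingType.
Implicit Types F G H : fps R.

HB.instance Definition _ := GRing.Zmodule.copy (fps R) (nat -> R).

Definition fps_const (c : R) : fps R := fun n => if n == 0%N then c else 0.
Definition fps_var : fps R := fun n => (n == 1%N)%:R.
Definition fps_mul F G : fps R := fun n => \sum_(k < n.+1) F k * G (n - k)%N.

Definition fps_trunc (n : nat) F : {poly R} := \poly_(i < n) F i.

Lemma coef_fps_truncM n m F G :
  (m < n)%N -> (fps_trunc n F * fps_trunc n G)`_m = fps_mul F G m.
Proof.
move=> mn; rewrite coefM; apply: eq_bigr => i _.
by rewrite !coef_poly !ifT // (leq_ltn_trans _ mn) ?leq_subr // -ltnS.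
Qed.

Lemma fps_mulA : associative fps_mul.
Proof.
move=> F G H; apply/funext => n.
transitivity ((fps_trunc n.+1 F * (fps_trunc n.+1 G * fps_trunc n.+1 H))`_n).
  rewrite coefM; apply: eq_bigr => i _.
  by rewrite coef_fps_truncM ?ltnS ?leq_subr // coef_poly ltn_ord.
rewrite mulrA coefM; apply: eq_bigr => i _.
by rewrite coef_fps_truncM // coef_poly ltnS leq_subr.
Qed.

Lemma fps_mulC : commutative fps_mul.
Proof.
by move=> F G; apply/funext => n; rewrite -!(@coef_fps_truncM n.+1) // mulrC.
Qed.

Lemma fps_mul1 : left_id (fps_const 1) fps_mul.
Proof.
move=> F; apply/funext => n; rewrite /fps_mul big_ord_recl /= subn0.
rewrite [X in X * _]/fps_const /= mul1r big1 ?addr0 // => i _.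
by rewrite /fps_const /= mul0r.
Qed.

Lemma fps_mulDl : left_distributive fps_mul +%R.
Proof.
move=> F G H; apply/funext => n.
transitivity (fps_mul F H n + fps_mul G H n) => //.
by rewrite /fps_mul -big_split; apply: eq_bigr => i _; exact: mulrDl.
Qed.

Lemma fps_one_neq0 : fps_const 1 != 0.
Proof.
apply/eqP => /(congr1 (fun F => F 0%N)).
by move=> /eqP; apply/negP; rewrite /fps_const /= oner_neq0.
Qed.

HB.instance Definition _ := GRing.Zmodule_isComNzRing.Build (fps R)
  fps_mulA fps_mulC fps_mul1 fps_mulDl fps_one_neq0.

End FPS.

Variant annulus_kind := OpenAnnulus | SemiOpenAnnulus | ClosedAnnulus.

Section Annulus.
Variables (K : fieldType) (ord : discrete_valuation K).
Local Notation R := (vring ord).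

(* F j i is the coefficient of X^i Y^j. The three cases are R[[X,Y]],
   R{X}[[Y]] and R{X,Y}. *)
Definition series_cond (k : annulus_kind) (F : fps (fps R)) : Prop :=
  match k with
  | OpenAnnulus => True
  | SemiOpenAnnulus => forall (j : nat) (N : int), exists n0 : nat,
      forall i : nat, (n0 <= i)%N -> (N%:E <= ord (F j i : K))%E
  | ClosedAnnulus => forall N : int, exists n0 : nat,
      forall i j : nat, (n0 <= i + j)%N -> (N%:E <= ord (F j i : K))%E
  end.

Definition series_pred (k : annulus_kind) : {pred fps (fps R)} :=
  fun F => `[< series_cond k F >].

Lemma ord_geD (N : \bar int) (x y : K) :
  (N <= ord x)%O -> (N <= ord y)%O -> (N <= ord (x + y))%O.
Proof. by move=> Nx Ny; apply: le_trans (valD ord x y); rewrite le_min Nx. Qed.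

Lemma ord_ge_sum (N : \bar int) n (x : 'I_n -> R) :
  (forall i, (N <= ord (x i : K))%O) -> (N <= ord (\sum_i x i : R))%O.
Proof.
move=> Nx; elim/big_rec: _ => [|i y _ Ny]; first by rewrite ord_pinfty0 leey.
by rewrite vring_valD; apply: ord_geD.
Qed.

Lemma ord_geMl (N : \bar int) (x y : R) :
  (N <= ord (x : K))%O -> (N <= ord (x * y : R))%O.
Proof.
by move=> Nx; rewrite vring_valM valM -[N]adde0 leeD //; exact: (valP y).
Qed.

Lemma ord_geMr (N : \bar int) (x y : R) :
  (N <= ord (y : K))%O -> (N <= ord (x * y : R))%O.
Proof. by rewrite mulrC; apply: ord_geMl. Qed.

Lemma coef_fps2M (F G : fps (fps R)) j i : (F * G) j i =
  \sum_(b < j.+1) \sum_(a < i.+1) F b a * G (j - b)%N (i - a)%N.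
Proof.
rewrite [LHS]/(fps_mul F G j i) /fps_mul.
exact: (big_morph (fun H : fps R => H i) (id1 := 0) (op1 := +%R)).
Qed.

Lemma coef_fps2_1 j i : (1 : fps (fps R)) j i = ((j == 0%N) && (i == 0%N))%:R.
Proof. by case: j i => [|j] [|i]. Qed.

Lemma series_pred_subring k : subring_closed (series_pred k).
Proof.
split.
- apply/asboolP; case: k => //= [j N|N]; exists 1%N => i.
    by rewrite coef_fps2_1 andbC; case: i => //= i _; rewrite ord_pinfty0 leey.
  move=> j; rewrite coef_fps2_1; case: j i => [|j] [|i] //= _;
    by rewrite ord_pinfty0 leey.
- move=> F G /asboolP cF /asboolP cG; apply/asboolP.
  case: k cF cG => //= cF cG => [j N|N].
    have [m mF] := cF j N; have [n nG] := cG j N.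
    exists (maxn m n) => i; rewrite geq_max => /andP[mi ni].
    by apply: ord_geD; [exact: mF | rewrite ordN; exact: nG].
  have [m mF] := cF N; have [n nG] := cG N.
  exists (maxn m n) => i j; rewrite geq_max => /andP[mi ni].
  by apply: ord_geD; [exact: mF | rewrite ordN; exact: nG].
- move=> F G /asboolP cF /asboolP cG; apply/asboolP.
  case: k cF cG => //= cF cG => [j N|N].
    have bnd (H : fps (fps R)) : series_cond SemiOpenAnnulus H ->
        exists n0 : nat, forall b i : nat, (b <= j)%N -> (n0 <= i)%N ->
          (N%:E <= ord (H b i : K))%O.
      move=> cH; elim: j {F G cF cG} => [|j [m IHm]].
        have [m mH] := cH 0%N N; exists m => b i.
        by rewrite leqn0 => /eqP -> /mH.
      have [n nH] := cH j.+1 N; exists (maxn m n) => b i.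
      rewrite geq_max leq_eqVlt => /orP[/eqP ->|bj] /andP[mi ni].
        exact: nH.
      exact: IHm.
    have [m mF] := bnd F cF; have [n nG] := bnd G cG.
    exists (m + n)%N => i mni; rewrite coef_fps2M; apply: ord_ge_sum => b.
    apply: ord_ge_sum => a; have [ma|am] := leqP m a.
      by apply/ord_geMl/mF; rewrite // -ltnS.
    apply/ord_geMr/nG; first exact: leq_subr.
    have ai : (a <= i)%N by rewrite -ltnS.
    by rewrite leq_subRL // (leq_trans _ mni) // leq_add2r ltnW.
  have [m mF] := cF N; have [n nG] := cG N.
  exists (m + n)%N => i j mnij; rewrite coef_fps2M; apply: ord_ge_sum => b.
  apply: ord_ge_sum => a; have [mab|abm] := leqP m (a + b).
    exact/ord_geMl/mF.
  apply/ord_geMr/nG; have ai : (a <= i)%N by rewrite -ltnS.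
  have bj : (b <= j)%N by rewrite -ltnS.
  rewrite -(leq_add2l m) (leq_trans mnij) // -{1}(subnK ai) -{1}(subnK bj).
  by rewrite addnACA addnC leq_add2r ltnW.
Qed.

HB.instance Definition _ k :=
  GRing.isSubringClosed.Build (fps (fps R)) (series_pred k)
    (series_pred_subring k).

Record series (k : annulus_kind) :=
  Series { series_val :> fps (fps R); _ : series_val \in series_pred k }.

HB.instance Definition _ k := [isSub for @series_val k].
HB.instance Definition _ k := [Choice of series k by <:].
HB.instance Definition _ k := [SubChoice_isSubComNzRing of series k by <:].

Lemma monomial_series k (c : R) (a b : nat) :
  (fun j i => if (j == b) && (i == a) then c else 0) \in series_pred k.
Proof.
apply/asboolP; case: k => //= [j N|N].
  exists a.+1 => i ai; rewrite (gtn_eqF ai) andbF ord_pinfty0; exact: leey.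
exists (a + b).+1 => i j abij; case: ifP => [/andP[/eqP jb /eqP ia]|_].
  by move: abij; rewrite jb ia ltnn.
by rewrite ord_pinfty0 leey.
Qed.

Lemma seriesC_subproof k (c : R) :
  fps_const (fps_const c) \in series_pred k.
Proof.
suff -> : fps_const (fps_const c) =
  (fun j i => if (j == 0%N) && (i == 0%N) then c else 0) :> (fps (fps R)).
  exact: monomial_series.
by apply/funext => -[|j]; apply/funext => -[|i].
Qed.

Lemma seriesX_subproof k : fps_const (fps_var R) \in series_pred k.
Proof.
suff -> : fps_const (fps_var R) =
  (fun j i => if (j == 0%N) && (i == 1%N) then 1 else 0) :> (fps (fps R)).
  exact: monomial_series.
by apply/funext => -[|j]; apply/funext => -[|[|i]].
Qed.

Lemma seriesY_subproof k : fps_var (fps R) \in series_pred k.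
Proof.
suff -> : fps_var (fps R) =
  (fun j i => if (j == 1%N) && (i == 0%N) then 1 else 0) :> (fps (fps R)).
  exact: monomial_series.
by apply/funext => -[|[|j]]; apply/funext => -[|i].
Qed.

Definition seriesC k (c : R) : series k := Series (seriesC_subproof k c).
Definition seriesX k : series k := Series (seriesX_subproof k).
Definition seriesY k : series k := Series (seriesY_subproof k).

Variables (pi : R) (k : annulus_kind) (e : nat).

(* phi induces an isomorphism from series k / (XY - pi^e) onto A, the ring of
   functions bounded by 1 on an annulus V; the Laurent pair is the image under
   phi of (X, Y). *)
Definition is_presentation (A : comUnitRingType)
    (phi : {rmorphism series k -> A}) : Prop :=
  (forall f : A, exists F : series k, phi F = f) /\
  (forall F : series k, phi F = 0 <->
    exists G : series k, F = (seriesX k * seriesY k - seriesC k pi ^+ e) * G).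

(* Coefficient of X^i in F(X, pi^e X^-1): the terms X^(i+n) Y^n of F
   contribute. *)
Definition coefX (F : series k) (i : int) : K :=
  ord_sum ord (fun n : nat =>
    if 0 <= i + n%:Z
    then (series_val F n (absz (i + n%:Z)) : K) * (pi : K) ^+ (e * n) else 0).

(* Coefficient of Y^j in F(pi^e Y^-1, Y): the terms X^n Y^(j+n) of F
   contribute. *)
Definition coefY (F : series k) (j : int) : K :=
  ord_sum ord (fun n : nat =>
    if 0 <= j + n%:Z
    then (series_val F (absz (j + n%:Z)) n : K) * (pi : K) ^+ (e * n) else 0).

(* The expansions of f are computed on an arbitrary lift of f to a power
   series; they do not depend on it since XY - pi^e is substituted by 0. *)
Section Expansions.
Variables (A : comUnitRingType) (phi : {rmorphism series k -> A}) (f : A).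

Definition lift_of : series k := xget 0 [set F | phi F = f]%classic.
Definition laurentX : int -> K := coefX lift_of.
Definition laurentY : int -> K := coefY lift_of.

End Expansions.

End Annulus.

(* eta_of, min_index and max_index are meaningful when the minimum (resp.
   maximum) exists, and 0 otherwise. *)
Section LaurentInvariants.
Variables (K : fieldType) (ord : discrete_valuation K) (a : int -> K).

Definition eta_of : int :=
  xget 0 [set m : int | (exists i : int, ord (a i) = m%:E) /\
                        (forall i : int, (m%:E <= ord (a i))%E)]%classic.

Definition min_index : int :=
  xget 0 [set i : int | ord (a i) = eta_of%:E /\
    (forall j : int, ord (a j) = eta_of%:E -> i <= j)]%classic.

Definition max_index : int :=
  xget 0 [set i : int | ord (a i) = eta_of%:E /\
    (forall j : int, ord (a j) = eta_of%:E -> j <= i)]%classic.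

End LaurentInvariants.

Section Invariants.
Variables (K : fieldType) (ord : discrete_valuation K) (pi : vring ord).
Variables (k : annulus_kind) (e : nat) (A : comUnitRingType).
Variables (phi : {rmorphism series ord k -> A}) (f : A).

Definition eta_X : int := eta_of ord (laurentX pi e phi f).
Definition v_X : int := min_index ord (laurentX pi e phi f).
Definition nu_X : int := max_index ord (laurentX pi e phi f).
Definition eta_Y : int := eta_of ord (laurentY pi e phi f).

Definition alpha_X : int := if k is OpenAnnulus then v_X else nu_X.

End Invariants.

(* B is the localization A[1/a]. *)
Definition is_localization_away (A B : comUnitRingType)
    (iota : {rmorphism A -> B}) (a : A) : Prop :=
  [/\ iota a \is a GRing.unit,
      forall x : A, iota x = 0 -> exists n : nat, a ^+ n * x = 0
    & forall b : B, exists (x : A) (n : nat), b = iota x / iota a ^+ n].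

(* Main.v *)
Require Import Defs.
From mathcomp Require Import all_boot all_order all_algebra.
From mathcomp Require Import boolp classical_sets.
From mathcomp Require Import constructive_ereal.
From mathcomp Require Import zify ring.

(** Write [D] for the expansion of [f] in [X], normalized so that the dominant
    coefficient of index [alpha] becomes [D_0 = 1]. A Toeplitz system, solved
    by successive approximation modulo powers of [pi], gives a unit power series
    [x(X)] with constant term [1] such that [D x] has no positive powers of
    [X]; hence the Y-expansion of [f x] starts at [Y^(- alpha)]. Since
    [X = pi^e / Y], multiplication by [x] does not change that expansion
    modulo [pi^(eta_Y(f) + 1)], so the same argument applied to it in the
    variable [Y] gives a unit [y(Y)] such that the expansion of [f x y] also
    stops, at the dominant index [beta] of the Y-expansion of [f]. Then
    [Y^alpha f x y] is a polynomial in [Y], equal to [pi^(eta_Y(f))] times a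
    unit constant times a monic polynomial. *)

Set Implicit Arguments.
Unset Strict Implicit.
Unset Printing Implicit Defensive.

Import Order.TTheory GRing.Theory Num.Theory.
Local Open Scope ring_scope.

(** * Ultrametric convergence of sequences and series in [K] *)

Section Limits.
Variables (K : fieldType) (ord : discrete_valuation K).
Local Notation R := (vring ord).
Local Notation vge N x := (N%R%:E <= ord x%R)%E.
Implicit Types (N M : int) (x y l : K) (s t : nat -> K).

Lemma vge0 N : vge N (0 : K).
Proof. by rewrite ord_pinfty0 leey. Qed.

Lemma vgeW N M x : N <= M -> vge M x -> vge N x.
Proof. by move=> NM; apply: le_trans; rewrite lee_fin. Qed.

Lemma vgeD N x y : vge N x -> vge N y -> vge N (x + y).
Proof. exact: ord_geD. Qed.

Lemma vgeN N x : vge N (- x) = vge N x.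
Proof. by rewrite ordN. Qed.

Lemma vgeB N x y : vge N x -> vge N y -> vge N (x - y).
Proof. by move=> Nx Ny; apply: vgeD; rewrite ?vgeN. Qed.

Lemma vgeBC N x y : vge N (x - y) = vge N (y - x).
Proof. by rewrite -[in RHS]vgeN opprB. Qed.

Lemma vgeM N M x y : vge N x -> vge M y -> vge (N + M) (x * y).
Proof. by move=> Nx My; rewrite Defs.valM EFinD leeD. Qed.

Lemma vge_vring (x : R) : vge 0 (x : K).
Proof. exact: (valP x). Qed.

Lemma vgeMl N x (y : R) : vge N x -> vge N (x * (y : K)).
Proof. by move=> Nx; rewrite -[N]addr0; apply/vgeM/vge_vring. Qed.

Lemma vgeMr N (x : R) y : vge N y -> vge N ((x : K) * y).
Proof. by rewrite mulrC; apply: vgeMl. Qed.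

Lemma vge_sum N (I : Type) (r : seq I) (P : pred I) (F : I -> K) :
  (forall i, P i -> vge N (F i)) -> vge N (\sum_(i <- r | P i) F i).
Proof.
move=> NF; elim/big_rec: _ => [|i x Pi Nx]; first exact: vge0.
by apply: vgeD => //; apply: NF.
Qed.

(** A nonzero element has finite valuation, so equalities in [K] may be checked up to elements of
    arbitrarily large valuation. *)
Lemma vge_eq0 x : (forall n : nat, vge n%:Z x) -> x = 0.
Proof.
move=> nx; apply/eqP/negPn/negP => x0; have [m mE] := ord_fin ord x0.
by have := nx (absz m).+1; rewrite mE lee_fin; lia.
Qed.

Lemma vring_val_sum (I : Type) (r : seq I) (P : pred I) (F : I -> R) :
  vring_val (\sum_(i <- r | P i) F i) = \sum_(i <- r | P i) vring_val (F i).
Proof. exact: (raddf_sum \val). Qed.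

Lemma ordV x (n : int) : ord x = n%:E -> ord x^-1 = (- n)%:E.
Proof.
move=> xn; have x0 : x != 0.
  by apply/eqP => x0; move: xn; rewrite x0 ord_pinfty0.
have [m mE] := ord_fin ord (invr_neq0 x0).
have := Defs.valM ord x x^-1; rewrite divff // Defs.ord1 xn mE => -[nm].
by congr EFin; lia.
Qed.

Lemma vge_div N (n : int) x y : ord y = n%:E -> vge N x -> vge (N - n) (x / y).
Proof. by move=> /ordV yn Nx; apply: vgeM => //; rewrite yn. Qed.

Lemma ord_neq0 x (n : int) : ord x = n%:E -> x != 0.
Proof. by move=> xn; rewrite -(val_pinfty ord) xn. Qed.

Lemma ord_eq x (n : int) : vge n x -> ~~ vge (n + 1) x -> ord x = n%:E.
Proof.
case: (ord x) (ord_ninfty ord x) => [m| |] _; rewrite ?leey //.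
by rewrite !lee_fin => nm nn; congr EFin; lia.
Qed.

Lemma ord_gtP x (n : int) : vge n x -> ord x != n%:E -> vge (n + 1) x.
Proof. by move=> nx; apply: contraNT => nn; apply/eqP/ord_eq. Qed.

Lemma ord_ltF x (n : int) : ord x = n%:E -> vge (n + 1) x = false.
Proof. by move=> ->; rewrite lee_fin; lia. Qed.

(** A perturbation of higher order does not affect the valuation. This is how the dominant index
    survives both multiplications. *)
Lemma ord_addl x y (n : int) :
  ord x = n%:E -> vge (n + 1) (y - x) -> ord y = n%:E.
Proof.
move=> xn yx; have nx : vge n x by rewrite xn.
apply: ord_eq.
  by rewrite -[y](subrK x); apply: vgeD => //; apply: vgeW yx; lia.
apply: contraFN (ord_ltF xn) => ny.
by rewrite -(subKr y x); apply: vgeB.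
Qed.

Definition nullseq s := forall N, exists n0 : nat, forall n : nat,
  (n0 <= n)%N -> vge N (s n).

Definition sums_to s l := ord_converges ord (fun n => \sum_(k < n) s k) l.

Lemma converges_uniq s l l' :
  ord_converges ord s l -> ord_converges ord s l' -> l = l'.
Proof.
move=> sl sl'; apply/eqP; rewrite -subr_eq0; apply/eqP/vge_eq0 => n.
have [p pl] := sl n; have [q ql'] := sl' n.
have -> : l - l' = (s (maxn p q) - l') - (s (maxn p q) - l) by ring.
by apply: vgeB; [apply: ql' | apply: pl]; rewrite ?leq_maxr ?leq_maxl.
Qed.

Lemma converges_eventually s t l n0 :
  (forall n, (n0 <= n)%N -> s n = t n) ->
  ord_converges ord s l -> ord_converges ord t l.
Proof.
move=> st sl N; have [p pl] := sl N.
exists (maxn n0 p) => n; rewrite geq_max => /andP[n0n pn].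
by rewrite -st //; apply: pl.
Qed.

Lemma convergesZ s l (c : K) :
  ord_converges ord s l -> ord_converges ord (fun n => c * s n) (c * l).
Proof.
have [->|c0] := eqVneq c 0.
  by move=> _ N; exists 0%N => n _; rewrite !mul0r subr0 vge0.
move=> sl N; have [m mE] := ord_fin ord c0; have [p pl] := sl (N - m).
exists p => n /pl; rewrite -mulrBr => h.
by rewrite -[N](addrNK m) addrC; apply: vgeM => //; rewrite mE.
Qed.

Lemma vge_lim N s l : ord_converges ord s l ->
  (exists n0 : nat, forall n, (n0 <= n)%N -> vge N (s n)) -> vge N l.
Proof.
move=> sl [p ps]; have [q ql] := sl N.
rewrite -[l](subKr (s (maxn p q))); apply: vgeB; [apply: ps | apply: ql];
  by rewrite ?leq_maxr ?leq_maxl.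
Qed.

Lemma sums_toZ s l (c : K) :
  sums_to s l -> sums_to (fun n => c * s n) (c * l).
Proof.
move=> /convergesZ-/(_ c); apply: (@converges_eventually _ _ _ 0%N) => n _.
by rewrite mulr_sumr.
Qed.

Lemma sums_toB s t l l' :
  sums_to s l -> sums_to t l' -> sums_to (fun n => s n - t n) (l - l').
Proof.
move=> sl tl N; have [p pl] := sl N; have [q ql] := tl N.
exists (maxn p q) => n; rewrite geq_max => /andP[pn qn].
rewrite big_split /= sumrN.
set a := \sum_(k < n) s k; set b := \sum_(k < n) t k.
have -> : a - b - (l - l') = (a - l) - (b - l') by ring.
by apply: vgeB; [apply: pl | apply: ql].
Qed.

Lemma sums_to_uniq s l l' : sums_to s l -> sums_to s l' -> l = l'.
Proof. exact: converges_uniq. Qed.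

Lemma eq_sums_to s t l : s =1 t -> sums_to s l -> sums_to t l.
Proof.
move=> st; apply: (@converges_eventually _ _ _ 0%N) => n _.
by apply: eq_bigr => k _; rewrite st.
Qed.

Lemma sums_to0 s : (forall n, s n = 0) -> sums_to s 0.
Proof. by move=> s0 N; exists 0%N => n _; rewrite big1 ?subrr ?vge0. Qed.

Lemma vge_sums_to N s l : sums_to s l -> (forall n, vge N (s n)) -> vge N l.
Proof.
by move=> /vge_lim sl Ns; apply: sl; exists 0%N => n _; apply: vge_sum.
Qed.

Lemma vge_sums_to_tail N s l p :
  sums_to s l -> (forall n, (p <= n)%N -> vge N (s n)) ->
  vge N (l - \sum_(k < p) s k).
Proof.
move=> sl Ns; have [q ql] := sl N.
have := ql (p + q)%N (leq_addl _ _); rewrite vgeBC => h.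
rewrite -[l](subrK (\sum_(k < p + q) s k)) -addrA; apply: vgeD => //.
rewrite big_split_ord /= addrC addKr; apply: vge_sum => i _.
by apply: Ns; rewrite leq_addr.
Qed.

Lemma sums_to_shift s l p :
  sums_to s l -> sums_to (fun n => s (p + n)%N) (l - \sum_(k < p) s k).
Proof.
move=> sl N; have [q ql] := sl N; exists q => n qn.
have := ql (p + n)%N (leq_trans qn (leq_addl _ _)).
by rewrite big_split_ord /= opprB addrCA addrA.
Qed.

Hypothesis K_complete : ord_complete ord.

(** By the ultrametric inequality a block of terms is as small as its largest term, so the partial
    sums are Cauchy. *)
Lemma nullseq_sum s : nullseq s -> exists l, sums_to s l.
Proof.
move=> s0; apply: K_complete => N; have [p pN] := s0 N.
have aux m n : (p <= m)%N -> (m <= n)%N ->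
    vge N (\sum_(k < n) s k - \sum_(k < m) s k).
  move=> pm mn; rewrite -(subnK mn) addnC big_split_ord /= addrAC subrr add0r.
  by apply: vge_sum => i _; apply: pN; rewrite (leq_trans pm) ?leq_addr.
exists p => m n pm pn; have [mn|/ltnW nm] := leqP m n; last exact: aux.
by rewrite vgeBC; apply: aux.
Qed.

Lemma ord_sumP s : nullseq s -> sums_to s (ord_sum ord s).
Proof.
move=> /nullseq_sum[l sl].
by apply: (@xgetPex _ 0 [set l | sums_to s l]%classic); exists l.
Qed.

Lemma ord_sum_eq s l : sums_to s l -> ord_sum ord s = l.
Proof.
move=> sl; apply: (@sums_to_uniq s) => //.
by apply: (@xgetPex _ 0 [set l | sums_to s l]%classic); exists l.
Qed.

End Limits.

Lemma sum_ord_cat (V : nmodType) (f : nat -> V) p n : (p <= n)%N ->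
  \sum_(i < n) f i = \sum_(i < p) f i + \sum_(i < n - p) f (p + i)%N.
Proof.
move=> pn; have [m ->] : exists m, n = (p + m)%N.
  by exists (n - p)%N; rewrite subnKC.
by rewrite addKn big_split_ord.
Qed.

(** * Inversion of formal power series with constant term 1 *)

Section InverseSeries.
Variable R : comNzRingType.
Implicit Types F G a : fps R.

Lemma fps_sumE (I : Type) (r : seq I) (P : pred I) (F : I -> fps R) n :
  (\sum_(i <- r | P i) F i) n = \sum_(i <- r | P i) F i n.
Proof. exact: (big_morph (fun H : fps R => H n) (id1 := 0) (op1 := +%R)). Qed.

Lemma fps_mulE F G n : (F * G) n = \sum_(k < n.+1) F k * G (n - k)%N.
Proof. by []. Qed.

Lemma fps_addE F G n : (F + G) n = F n + G n.
Proof. by []. Qed.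

Lemma fps_oppE F n : (- F) n = - F n.
Proof. by []. Qed.

Lemma fps_1E n : (1 : fps R) n = (n == 0)%:R.
Proof. by case: n. Qed.

Lemma fps_expr_lt F j m : F 0%N = 0 -> (m < j)%N -> (F ^+ j) m = 0.
Proof.
move=> F0; elim: j m => // j IHj m mj.
rewrite exprS fps_mulE big1 // => -[[|k] /= km] _; first by rewrite F0 mul0r.
by rewrite IHj ?mulr0 //; lia.
Qed.

(* The inverse of [1 - F] is the geometric series in [F]. *)
Lemma fps_unit a : a 0%N = 1 -> exists b : fps R, a * b = 1.
Proof.
move=> a0; pose F := 1 - a.
have F0 : F 0%N = 0 by rewrite /F fps_addE fps_oppE a0 fps_1E subrr.
pose g n := \sum_(j < n) F ^+ j.
have gE n m : (m < n)%N -> g n m = g m.+1 m.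
  move=> mn; rewrite /g -(subnK mn) addnC big_split_ord /= fps_addE.
  rewrite [X in _ + X]fps_sumE [X in _ + X]big1 ?addr0 // => i _.
  by rewrite fps_expr_lt //; lia.
exists (fun n => g n.+1 n); apply/funext => n.
have -> : (a * (fun n => g n.+1 n)) n = (a * g n.+1) n.
  rewrite !fps_mulE; apply: eq_bigr => k _; congr (_ * _).
  by rewrite (gE n.+1) //; lia.
have -> : a * g n.+1 = 1 - F ^+ n.+1.
  by rewrite -opprB subrX1 -mulNr opprB subKr.
by rewrite fps_addE fps_oppE fps_expr_lt // subr0.
Qed.

End InverseSeries.

(** * The Toeplitz system, solved by successive approximation *)

Section Toeplitz.
Variables (K : fieldType) (ord : discrete_valuation K).
Hypothesis K_complete : ord_complete ord.
Local Notation R := (vring ord).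
Local Notation vge N x := (N%R%:E <= ord x%R)%E.

Lemma vringP (v : K) : vge 0 v -> exists r : R, vring_val r = v.
Proof. by move=> v0; exists (VRing v0). Qed.

Lemma vring_fps_mul (y a : fps R) m : vring_val ((y * a) m) =
  \sum_(i < m.+1) vring_val (y i) * vring_val (a (m - i)%N).
Proof. by rewrite vring_val_sum; apply: eq_bigr => i _; rewrite vring_valM. Qed.

Lemma vge_fps_mul N (y a : fps R) :
  (forall i, vge N (y i)) -> forall m, vge N ((y * a) m).
Proof.
move=> Ny m; rewrite vring_fps_mul; apply: vge_sum => i _; exact: vgeMl.
Qed.

(** In the recursion for [y m], each term contains either some [x i] of large index, which is small,
    or some [y j] of large index; in the second case the factor from [x] has positive valuation and
    improves the bound by one. *)
Lemma fps_inv_null (x y : fps R) : x * y = 1 ->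
  (forall i, (0 < i)%N -> vge 1 (x i)) -> x 0%N = 1 ->
  nullseq ord (fun n => x n) -> nullseq ord (fun n => y n).
Proof.
move=> xy1 x1 x0 xnull.
have yE m : (0 < m)%N -> vring_val (y m) =
    - \sum_(i < m) vring_val (x i.+1) * vring_val (y (m - i.+1)%N).
  move=> m0; have := congr1 (fun F : fps R => vring_val (F m)) xy1.
  rewrite vring_fps_mul big_ord_recl x0 mul1r subn0 fps_1E gtn_eqF // => /eqP.
  by rewrite addr_eq0 => /eqP.
suff H (t : nat) : exists n0 : nat, forall n, (n0 <= n)%N -> vge t%:Z (y n).
  move=> N; have [n0 h] := H (absz N); exists n0 => n /h; apply: vgeW; lia.
elim: t => [|t [p pt]]; first by exists 0%N => n _; apply: vge_vring.
have [q qt] := xnull t.+1%:Z; exists (p + q).+1 => n pqn.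
rewrite yE; last by lia.
rewrite vgeN; apply: vge_sum => i _; have [qi|iq] := leqP q i.+1.
  exact/vgeMl/qt.
have -> : t.+1%:Z = 1 + t%:Z by lia.
by apply: vgeM; [apply: x1 | apply: pt; lia].
Qed.

Variable D : int -> R.
Hypothesis D0 : D 0 = 1.
Hypothesis Dnull : nullseq ord (fun i => D (- i%:Z)).

(** A partial sum of the coefficient of index [m] in the product of the two-sided series [D] and the
    power series [x]. *)
Definition toep (x : nat -> R) (m n : nat) : K :=
  \sum_(i < n) vring_val (D (m%:Z - i%:Z)) * vring_val (x i).

(** The bound [L] can be uniform in [m]: terms with [i] far beyond [m] involve [D] only at very
    negative indices, where [Dnull] makes it small. *)
Definition toep_small (t : nat) (x : nat -> R) := exists L : nat,
  forall m n : nat, (0 < m)%N -> (m + L <= n)%N -> vge t%:Z (toep x m n).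

Lemma toepD (x y : nat -> R) m n :
  toep (fun i => x i + y i) m n = toep x m n + toep y m n.
Proof.
rewrite /toep -big_split; apply: eq_bigr => i _ /=.
exact: mulrDr.
Qed.

Lemma toep_cat x m p n : (p <= n)%N -> toep x m n = toep x m p +
  \sum_(i < n - p) vring_val (D (m%:Z - (p + i)%:Z)) * vring_val (x (p + i)%N).
Proof.
exact: (@sum_ord_cat _
  (fun i => vring_val (D (m%:Z - i%:Z)) * vring_val (x i))).
Qed.

(** Up to positive valuation, [D] has only nonnegative indices and is an invertible power series.
    Dividing the residual by it gives a correction of valuation at least [t], and the neglected
    negative indices cost an error of valuation at least [t.+1]. *)
Lemma toep_small_step_lower (t : nat) x : toep_small t x ->
  (forall i, (0 < i)%N -> vge 1 (D (- i%:Z))) ->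
  exists y : nat -> R, [/\ y 0%N = 0, forall i, vge t%:Z (y i)
    & toep_small t.+1 (fun i => x i + y i)].
Proof.
move=> [L1 tx] D1; have [L0 DL] := Dnull t.+1; pose L := maxn L0 L1.
(* The residual, cut off at [m + L], where the later terms have valuation at least [t.+1]. Its value
   0 at [m = 0] forces [y 0 = 0], which keeps the constant term of [x]. *)
pose r m : R := if m is 0%N then 0 else
  \sum_(i < m + L) D (m%:Z - i%:Z) * x i.
have rE m : (0 < m)%N -> vring_val (r m) = toep x m (m + L).
  case: m => // m _; rewrite vring_val_sum.
  by apply: eq_bigr => i _; rewrite vring_valM.
have [b ab] := @fps_unit R (fun i : nat => D i) D0.
pose y : fps R := - ((r : fps R) * b).
have yt i : vge t%:Z (y i).
  rewrite /y fps_oppE vring_valN vgeN.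
  apply: vge_fps_mul => -[|j]; first exact: vge0.
  by rewrite rE //; apply: tx; rewrite // leq_add2l leq_maxr.
have ya : y * (fun i : nat => D i) = - (r : fps R).
  by rewrite /y mulNr -mulrA [b * _]mulrC ab mulr1.
exists y; split=> //.
  rewrite /y fps_oppE fps_mulE big_ord1 /=.
  by rewrite mul0r oppr0.
exists L.+1 => m n m0 mn; rewrite toepD.
rewrite (@toep_cat x m (m + L)); last by lia.
rewrite (@toep_cat y m m.+1); last by lia.
have -> : toep y m m.+1 = - toep x m (m + L).
  rewrite -rE // -vring_valN -(fps_oppE (r : fps R)) -ya vring_fps_mul.
  apply: eq_bigr => i _; rewrite mulrC; congr (_ * vring_val (D _)).
  by have := ltn_ord i; lia.
rewrite addrACA subrr add0r; apply: vgeD; apply: vge_sum => i _.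
  apply: vgeMl; have -> : m%:Z - (m + L + i)%:Z = - (L + i)%:Z by lia.
  by apply: DL; rewrite /L; lia.
have -> : t.+1%:Z = 1 + t%:Z by lia.
apply: vgeM => //; have -> : m%:Z - (m.+1 + i)%:Z = - i.+1%:Z by lia.
exact: D1.
Qed.

(* Modulo [pi ^ (t + 1)] the system is finite and upper triangular: reversing
   the indices reduces it to the inversion of a power series. *)
Lemma toep_small_step_upper (t : nat) x : toep_small t x ->
  (forall i : nat, (0 < i)%N -> vge 1 (D i%:Z)) ->
  nullseq ord (fun i => D i%:Z) ->
  (exists M : nat, forall i, (M <= i)%N -> x i = 0) ->
  exists y : nat -> R, [/\ y 0%N = 0, forall i, vge t%:Z (y i),
    toep_small t.+1 (fun i => x i + y i)
    & exists M : nat, forall i, (M <= i)%N -> y i = 0].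
Proof.
move=> [L1 tx] D1 Dpnull [Mx xM].
have [L0 DL] := Dnull t.+1; pose L := maxn L0 L1.
(* Rows from [M] on already hold to order [t.+1]: [x] vanishes from [Mx] on, so [D] occurs there
   only at indices at least [M0]. *)
have [M0 DM] := Dpnull t.+1; pose M := (M0 + Mx)%N.
pose r m : R := \sum_(i < m + L) D (m%:Z - i%:Z) * x i.
have rE m : vring_val (r m) = toep x m (m + L).
  rewrite vring_val_sum.
  by apply: eq_bigr => i _; rewrite vring_valM.
have rt m : (0 < m)%N -> vge t%:Z (r m).
  by move=> m0; rewrite rE //; apply: tx; rewrite // leq_add2l leq_maxr.
have rM m : (M <= m)%N -> vge t.+1%:Z (r m).
  move=> Mm; rewrite rE; apply: vge_sum => i _.
  have [iM|Mi] := ltnP i Mx; last by rewrite xM // mulr0 vge0.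
  apply: vgeMl; have -> : m%:Z - i%:Z = (m - i)%N by move: Mm; rewrite /M; lia.
  by apply: DM; move: Mm; rewrite /M; lia.
(* Under the reversal [i = M - l] the system becomes a product of [z] with the nonpositive part of
   [D]. The condition [k < M] leaves out row 0, on which no equation is imposed. *)
pose rr k : R := if (k < M)%N then r (M - k)%N else 0.
have [b ab] := @fps_unit R (fun i : nat => D (- i%:Z)) D0.
pose z : fps R := - ((rr : fps R) * b).
have zt i : vge t%:Z (z i).
  rewrite /z fps_oppE vring_valN vgeN.
  apply: vge_fps_mul => k; rewrite /rr; case: ifP => kM; last exact: vge0.
  by apply: rt; rewrite subn_gt0.
have za : z * (fun i : nat => D (- i%:Z)) = - (rr : fps R).
  by rewrite /z mulNr -mulrA [b * _]mulrC ab mulr1.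
pose y i : R := if (0 < i <= M)%N then z (M - i)%N else 0.
have yt i : vge t%:Z (y i) by rewrite /y; case: ifP => // _; apply: vge0.
have yM i : (M < i)%N -> y i = 0.
  by rewrite /y => Mi; rewrite [_ && _]andbC leqNgt Mi.
exists y; split=> //; last by exists M.+1.
exists (maxn L M.+1) => m n m0 mn; rewrite toepD.
rewrite (@toep_cat x m (m + L)); last by lia.
rewrite (@toep_cat y m M.+1); last by lia.
rewrite [X in _ + (_ + X)]big1 ?addr0; last first.
  by move=> i _; rewrite yM ?mulr0 //; lia.
rewrite addrAC; apply: vgeD; last first.
  apply: vge_sum => i _.
  apply: vgeMl; have -> : m%:Z - (m + L + i)%:Z = - (L + i)%:Z by lia.
  by apply: DL; rewrite /L; lia.
have -> : toep y m M.+1 =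
    \sum_(l < M) vring_val (D (m%:Z - M%:Z + l%:Z)) * vring_val (z l).
  rewrite /toep (reindex_inj rev_ord_inj) /= big_ord_recr /=.
  rewrite subSS subnn /y ltnn /= mulr0 addr0; apply: eq_bigr => l _.
  have lM := ltn_ord l; rewrite subSS ifT; last by lia.
  congr (vring_val (D _) * vring_val (z _)); lia.
rewrite -rE; have t1 : t.+1%:Z = 1 + t%:Z by lia.
(* For [m > M] the residual is small and [z] meets [D] at positive indices only. For [m <= M] the
   terms [l <= M - m] cancel the residual exactly, and the others carry [D] at a positive index. *)
have [mM|Mm] := ltnP M m.
  apply: vgeD; first by apply: rM; lia.
  apply: vge_sum => l _; rewrite t1; apply: vgeM => //.
  have -> : m%:Z - M%:Z + l%:Z = (m - M + l)%N by lia.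
  by apply: D1; lia.
have kM : (M - m < M)%N by lia.
have -> : r m = rr (M - m)%N by rewrite /rr kM subKn.
rewrite (@sum_ord_cat _
  (fun l => vring_val (D (m%:Z - M%:Z + l%:Z)) * vring_val (z l)) _ _ kM).
have -> : vring_val (rr (M - m)%N) = - vring_val ((- (rr : fps R)) (M - m)%N).
  by rewrite fps_oppE vring_valN opprK.
rewrite -za vring_fps_mul addrA addrC.
set A := \sum_(i < _) _; set B := \sum_(i < _) _.
rewrite [X in _ + X](_ : _ = 0) ?addr0; last first.
  apply/eqP; rewrite addrC subr_eq0; apply/eqP/eq_bigr => i _; rewrite mulrC.
  congr (vring_val _ * vring_val (D _)); have := ltn_ord i; lia.
apply: vge_sum => i _; rewrite t1; apply: vgeM => //.
have -> : m%:Z - M%:Z + ((M - m).+1 + i)%N%:Z = i.+1%:Z by lia.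
exact: D1.
Qed.

(** The flag [b] marks the case where [x] must converge on the closed disc; the approximations are
    then polynomials. *)
Definition toep_approx (b : bool) (t : nat) (x : nat -> R) :=
  [/\ x 0%N = 1, toep_small t x
    & b -> (forall i, (0 < i)%N -> vge 1 (x i)) /\
           (exists M : nat, forall i, (M <= i)%N -> x i = 0)].

Lemma toeplitz (b : bool) :
  (if b then (forall i : nat, (0 < i)%N -> vge 1 (D i%:Z)) /\
             nullseq ord (fun i => D i%:Z)
   else forall i : nat, (0 < i)%N -> vge 1 (D (- i%:Z))) ->
  exists x : nat -> R, [/\ x 0%N = 1,
    forall m : nat, (0 < m)%N -> ord_converges ord (toep x m) 0
    & b -> (forall i, (0 < i)%N -> vge 1 (x i)) /\ nullseq ord (fun i => x i)].
Proof.
move=> bD.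
have step t x : (b <= t)%N -> toep_approx b t x -> exists y : nat -> R,
    toep_approx b t.+1 y /\ forall i, vge t%:Z (y i - x i : R).
  case: b bD => [[D1 Dn] t1 [x0 xt /(_ isT)[x1 xM]]|D1 _ [x0 xt _]].
    have [y [y0 yt xyt yM]] := toep_small_step_upper xt D1 Dn xM.
    exists (fun i => x i + y i); split; last by move=> i; rewrite addrC addKr.
    split=> //; first by rewrite x0 y0 addr0.
    move=> _; split=> [i i0|].
      rewrite vring_valD; apply: vgeD; first exact: x1.
      by apply: vgeW (yt i); lia.
    have [M1 h1] := xM; have [M2 h2] := yM; exists (maxn M1 M2) => i.
    by rewrite geq_max => /andP[/h1-> /h2->]; rewrite addr0.
  have [y [y0 yt xyt]] := toep_small_step_lower xt D1.
  exists (fun i => x i + y i); split; last by move=> i; rewrite addrC addKr.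
  by split=> //; rewrite x0 y0 addr0.
have /choice[F FP] : forall p : nat * (nat -> R), exists y : nat -> R,
    (b <= p.1)%N -> toep_approx b p.1 p.2 ->
    toep_approx b p.1.+1 y /\ forall i, vge p.1%:Z (y i - p.2 i : R).
  move=> [t x]; have [h|h] := pselect ((b <= t)%N /\ toep_approx b t x).
    by have [y yP] := step t x h.1 h.2; exists y.
  by exists x => bt xt; case: h.
(* The iteration starts from the constant series 1 at order [b], read as 0 or 1: at order 1 the
   system holds because [D] has positive valuation at positive indices. Later corrections then keep
   [x i] of positive valuation for [i > 0]. *)
pose delta (i : nat) : R := (i == 0%N)%:R.
have delta_approx : toep_approx b b delta.
  split=> //.
    exists 1%N => m n m0 mn; case: b bD {step FP} => [[D1 _]|_]; last first.
      by apply: vge_sum => i _; rewrite -vring_valM; apply: vge_vring.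
    apply: vge_sum => -[[|i] ilt] _; last by rewrite mulr0 vge0.
    by apply: vgeMl; rewrite /= subr0; apply: D1.
  move=> _; split=> [[|i]|] //; first by rewrite vge0.
  by exists 1%N => -[|i].
pose fix xs (n : nat) : nat -> R :=
  if n is n'.+1 then F ((b + n')%N, xs n') else delta.
have xsP n : toep_approx b (b + n) (xs n) /\
    forall i, vge n%:Z (xs n.+1 i - xs n i : R).
  have ok : toep_approx b (b + n) (xs n).
    elim: n => [|n IHn]; first by rewrite addn0.
    by have [+ _] := FP ((b + n)%N, xs n) (leq_addr _ _) IHn; rewrite addnS.
  split=> // i; have [_ /(_ i) h] := FP ((b + n)%N, xs n) (leq_addr _ _) ok.
  by apply: vgeW h => /=; lia.
have /choice[x xP] : forall i, exists xi : R,
    forall n, vge n%:Z (xi - xs n i : R).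
  (* The corrections tend to 0, so their telescoping series converges; the limit is integral and
     agrees with [xs n] up to valuation [n]. *)
  move=> i; pose s n : K := xs n.+1 i - xs n i : R.
  have snull : nullseq ord s.
    by move=> N; exists (absz N) => n Nn; apply: vgeW ((xsP n).2 i); lia.
  have [l sl] := nullseq_sum K_complete snull.
  have l0 : vge 0 l.
    by apply: vge_sums_to sl _ => n; apply: vge_vring.
  have [r rl] := vringP l0; exists (xs 0%N i + r) => n.
  have -> : vring_val (xs 0%N i + r - xs n i) = l - \sum_(k < n) s k.
    rewrite !vring_valD vring_valN rl.
    have -> : \sum_(k < n) s k = vring_val (xs n i) - vring_val (xs 0%N i).
      elim: n => [|n IHn]; first by rewrite big_ord0 subrr.
      by rewrite big_ord_recr IHn /s vring_valD vring_valN /=; ring.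
    by ring.
  apply: vge_sums_to_tail sl _ => m nm.
  by apply: vgeW ((xsP m).2 i); lia.
exists x; split.
- apply/eqP; rewrite -subr_eq0; apply/eqP/val_inj/(@vge_eq0 _ ord) => n.
  by have [[<- _ _] _] := xsP n; apply: xP.
- move=> m m0 N; have [[_ [L xL] _] _] := xsP (absz N).
  exists (m + L)%N => n mn; rewrite subr0.
  have -> : toep x m n = toep (xs (absz N)) m n +
      toep (fun i => x i - xs (absz N) i) m n.
    rewrite -toepD; apply: eq_bigr => i _.
    by congr (_ * vring_val _); rewrite addrC subrK.
  apply: vgeD; first by apply: vgeW (xL _ _ m0 mn); lia.
  apply: vge_sum => i _; apply: vgeMr.
  by apply: vgeW (xP i (absz N)); lia.
(* Up to valuation [N], [x] coincides with an approximation of finite support, hence it tends to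
   0. *)
- move=> bT; split=> [i i0|N].
    have [[_ _ /(_ bT)[/(_ i i0) h _]] _] := xsP 1%N.
    rewrite -[x i](subrK (xs 1%N i)) vring_valD; apply: vgeD => //.
    exact: (xP i 1%N).
  have [[_ _ /(_ bT)[_ [M xM]]] _] := xsP (absz N).
  exists M => i Mi; have := xP i (absz N); rewrite xM // subr0.
  by apply: vgeW; lia.
Qed.

End Toeplitz.

(** * Products of power series in one and two variables *)

Section UnivariateProducts.
Variable R : comNzRingType.
Implicit Types p q : fps R.

Lemma fps_constM (c : R) p n : (fps_const c * p) n = c * p n.
Proof.
rewrite fps_mulE big_ord_recl subn0 big1 ?addr0 // => i _.
by rewrite /fps_const /= mul0r.
Qed.

Lemma fps_varM p n :
  (fps_var R * p) n = if n is n'.+1 then p n' else 0.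
Proof.
rewrite fps_mulE; case: n => [|n]; rewrite big_ord_recl /fps_var mul0r add0r.
  by rewrite big_ord0.
by rewrite big_ord_recl mul1r subn1 big1 ?addr0 // => i _; rewrite mul0r.
Qed.

Lemma fps_constXM (c : R) p m n : (fps_const c ^+ m * p) n = c ^+ m * p n.
Proof.
elim: m => [|m IHm]; first by rewrite !mul1r.
by rewrite !exprS -!mulrA fps_constM IHm.
Qed.

End UnivariateProducts.

Section BivariateProducts.
Variable R : comNzRingType.
Implicit Types (F G : fps (fps R)) (p q : fps R).

(** [fpsY] and [fpsX] embed R[[Y]] and R[[X]] into R[[X]][[Y]]. *)
Definition fpsY q : fps (fps R) := fun j => fps_const (q j).
Definition fpsX p : fps (fps R) := fps_const p.

Lemma fpsYE q j i : fpsY q j i = if i == 0%N then q j else 0.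
Proof. by []. Qed.

Lemma fpsY_mulE q F j i :
  (fpsY q * F) j i = \sum_(b < j.+1) F (j - b)%N i * q b.
Proof.
rewrite fps_mulE fps_sumE; apply: eq_bigr => b _.
by rewrite fps_constM mulrC.
Qed.

Lemma fpsX_mulE p F j i :
  (fpsX p * F) j i = \sum_(a < i.+1) F j (i - a)%N * p a.
Proof.
rewrite /fpsX fps_constM fps_mulE.
by apply: eq_bigr => a _; rewrite mulrC.
Qed.

Lemma fpsYM p q : fpsY (p * q) = fpsY p * fpsY q.
Proof.
apply/funext => j; apply/funext => i; rewrite fpsY_mulE fpsYE fps_mulE.
case: i => [|i] /=; last by rewrite big1 // => b _; rewrite fpsYE mul0r.
by apply: eq_bigr => b _; rewrite mulrC.
Qed.

Lemma fpsXM p q : fpsX (p * q) = fpsX p * fpsX q.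
Proof.
apply/funext => j; rewrite /fpsX fps_constM /fps_const.
by case: j => //=; rewrite mulr0.
Qed.

Lemma fpsY1 : fpsY 1 = 1.
Proof. by apply/funext => -[|j]; apply/funext => -[|i]. Qed.

Definition fps_swap F : fps (fps R) := fun i j => F j i.

Lemma fpsX_swap p F : fpsX p * F = fps_swap (fpsY p * fps_swap F).
Proof.
apply/funext => j; apply/funext => i; rewrite fpsX_mulE.
by rewrite /fps_swap fpsY_mulE.
Qed.

(** The product [XY] shifts both indices by one, which makes division by [XY - c^e] a recursion
    along diagonals. *)
Lemma laurent_relM (c : R) (e : nat) G j i :
  ((fpsX (fps_var R) * fps_var (fps R) - fpsX (fps_const c) ^+ e) * G) j i =
  (if j is j'.+1 then if i is i'.+1 then G j' i' else 0 else 0)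
  - c ^+ e * G j i.
Proof.
rewrite mulrBl !fps_addE !fps_oppE !fps_constXM -mulrA; congr (_ - _).
rewrite /fpsX fps_constM fps_varM; case: i => [|i]; first by case: j.
by rewrite fps_varM; case: j.
Qed.

End BivariateProducts.

(** * Laurent expansions and the kernel of the substitution [XY = pi^e] *)

Section LaurentExpansion.
Variables (K : fieldType) (ord : discrete_valuation K).
Hypothesis K_complete : ord_complete ord.
Local Notation R := (vring ord).
Local Notation vge N x := (N%R%:E <= ord x%R)%E.
Variables (pi : R) (e : nat).
Hypothesis pi_uniformizer : ord pi = (1 : int)%:E.
Hypothesis e_ge1 : (0 < e)%N.
Implicit Types F G : fps (fps R).

Lemma vring_valX (x : R) n : vring_val (x ^+ n) = vring_val x ^+ n.
Proof. exact: (rmorphXn \val). Qed.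

Lemma pi_neq0 : (pi : K) != 0.
Proof. exact: ord_neq0 pi_uniformizer. Qed.

Lemma ord_pi_exp n : ord ((pi : K) ^+ n) = (n%:Z)%:E.
Proof.
elim: n => [|n IHn]; first by rewrite expr0 Defs.ord1.
by rewrite exprS Defs.valM IHn pi_uniformizer -EFinD; congr EFin; lia.
Qed.

Lemma vge_pi_exp (N : int) (n : nat) : N <= n%:Z -> vge N ((pi : K) ^+ (e * n)).
Proof.
move=> Nn; rewrite ord_pi_exp lee_fin (le_trans Nn) // lez_nat.
by rewrite leq_pmull.
Qed.

(** The relation turns [X^(i+n) Y^(j+n)] into [pi^(e n) X^i Y^j]; [diag] collects these
    contributions. *)
Definition diag_term F j i n : K :=
  (F (j + n)%N (i + n)%N : K) * (pi : K) ^+ (e * n).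
Definition diag F j i : K := ord_sum ord (diag_term F j i).

Lemma vge_diag_term F j i (N : int) (n : nat) : N <= n%:Z ->
  vge N (diag_term F j i n).
Proof. by move=> Nn; apply/vgeMr/vge_pi_exp. Qed.

Lemma nullseq_bounded (s : nat -> K) :
  (forall (N : int) (n : nat), N <= n%:Z -> vge N (s n)) -> nullseq ord s.
Proof. by move=> h N; exists (absz N) => n Nn; apply: h; lia. Qed.

Lemma diagP F j i : sums_to ord (diag_term F j i) (diag F j i).
Proof.
apply: ord_sumP => //; apply: nullseq_bounded => N n; exact: vge_diag_term.
Qed.

Lemma diag_rec F j i :
  diag F j i = (F j i : K) + (pi : K) ^+ e * diag F j.+1 i.+1.
Proof.
have h1 := sums_to_shift 1 (diagP F j i).
have h2 := sums_toZ ((pi : K) ^+ e) (diagP F j.+1 i.+1).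
have -> : (pi : K) ^+ e * diag F j.+1 i.+1 = diag F j i - (F j i : K).
  apply: sums_to_uniq h2 _.
  have -> : vring_val (F j i) = \sum_(k < 1) diag_term F j i k.
    by rewrite big_ord1 /diag_term !addn0 muln0 mulr1.
  apply: eq_sums_to h1 => n; rewrite /diag_term add1n !addSnnS.
  by rewrite mulnS exprD; ring.
by rewrite addrC subrK.
Qed.

(** Terms of rank at least [|N|] are divisible by [pi^N] through the factor [pi^(e n)], as [e >= 1];
    only finitely many coefficients of [F] remain to be controlled. *)
Lemma vge_diag F j i (N : int) :
  (forall n, (n < absz N)%N -> vge N (F (j + n)%N (i + n)%N)) ->
  vge N (diag F j i).
Proof.
move=> h; apply: vge_sums_to (diagP F j i) _ => n.
have [nN|Nn] := ltnP n (absz N); last by apply: vge_diag_term; lia.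
apply: vgeW (_ : vge (N + 0) _); first by rewrite addr0.
by apply: vgeM; [apply: h | rewrite ord_pi_exp lee_fin].
Qed.

Lemma vge0_diag F j i : vge 0 (diag F j i).
Proof. exact: vge_diag. Qed.

(* Up to conversion, [coefY pi e S] and [coefX pi e S] are [cfY] and [cfX] of
   the underlying series of [S]. *)
Definition cfY_term F (j : int) (n : nat) : K :=
  if 0 <= j + n%:Z then (F (absz (j + n%:Z)) n : K) * (pi : K) ^+ (e * n)
  else 0.
Definition cfY F j : K := ord_sum ord (cfY_term F j).
Definition cfX F i : K := cfY (fps_swap F) i.

Lemma vge_cfY_term F j (N : int) (n : nat) :
  N <= n%:Z -> vge N (cfY_term F j n).
Proof.
rewrite /cfY_term; case: ifP => _ Nn; last exact: vge0.
exact/vgeMr/vge_pi_exp.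
Qed.

Lemma cfYP F j : sums_to ord (cfY_term F j) (cfY F j).
Proof.
apply: ord_sumP => //; apply: nullseq_bounded => N n; exact: vge_cfY_term.
Qed.

Lemma vge0_cfY F j : vge 0 (cfY F j).
Proof.
by apply: vge_sums_to (cfYP F j) _ => n; apply: vge_cfY_term.
Qed.

Lemma cfY_diag F (j : nat) : cfY F j = diag F j 0.
Proof.
apply: ord_sum_eq; apply: eq_sums_to (diagP F j 0) => n.
by rewrite /cfY_term /diag_term -PoszD.
Qed.

Lemma cfX_diag F (i : nat) : cfX F i = diag F 0 i.
Proof.
apply: ord_sum_eq; apply: eq_sums_to (diagP F 0 i) => n.
by rewrite /cfY_term /diag_term -PoszD.
Qed.

(** This is [X^i = pi^(e i) Y^(- i)]; the first [i] terms on the left vanish, since they would need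
    a negative power of [Y] in [F]. *)
Lemma cfYN F (i : nat) : cfY F (- i%:Z) = cfX F i * (pi : K) ^+ (e * i).
Proof.
have h1 := sums_to_shift i (cfYP F (- i%:Z)).
have h2 := sums_toZ ((pi : K) ^+ (e * i)) (cfYP (fps_swap F) i%:Z).
rewrite mulrC; apply: sums_to_uniq _ h2.
have <- : cfY F (- i%:Z) - \sum_(k < i) cfY_term F (- i%:Z) k = cfY F (- i%:Z).
  rewrite big1 ?subr0 // => k _; have ki := ltn_ord k.
  by rewrite /cfY_term ifF //; lia.
apply: eq_sums_to h1 => n.
rewrite /cfY_term ifT; last by lia.
rewrite (_ : absz (- i%:Z + (i + n)%N) = n); last by lia.
by rewrite /fps_swap mulnDr exprD /=; ring.
Qed.

Lemma cfX_cfY F (j : int) : cfY F j = cfX F (- j) * (pi : K) ^ (- (e%:Z * j)).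
Proof.
have pi0 := pi_neq0; case: (intP j) => [|n|n].
- by rewrite mulr0 oppr0 mulr1 -[0 in LHS]oppr0 -[0]/(0%N%:Z) cfYN muln0 mulr1.
- rewrite (_ : cfX F _ = cfY F n.+1 * (pi : K) ^+ (e * n.+1)).
    by rewrite -PoszM -exprnN mulfK // expf_neq0.
  by rewrite /cfX cfYN.
- by rewrite cfYN opprK mulrN opprK -PoszM.
Qed.

Lemma cfYB F G j : cfY (F - G) j = cfY F j - cfY G j.
Proof.
apply: ord_sum_eq; apply: eq_sums_to (sums_toB (cfYP F j) (cfYP G j)) => n.
rewrite /cfY_term; case: ifP => _; last by rewrite subrr.
by rewrite -mulrBl -vring_valN -vring_valD.
Qed.

Lemma cfY_fpsY (q : fps R) (j : int) :
  cfY (fpsY q) j = if 0 <= j then vring_val (q (absz j)) else 0.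
Proof.
apply: ord_sum_eq => N; exists 1%N => -[//|n] _.
rewrite big_ord_recl big1 /cfY_term => [|i _]; last first.
  by rewrite fpsYE /=; case: ifP => _; rewrite ?mul0r.
by rewrite !addr0 muln0 mulr1 /= fpsYE /= subrr vge0.
Qed.

Lemma cfY_mul F (q : fps R) (m : int) :
  sums_to ord (fun i => cfY F (m - i%:Z) * (q i : K)) (cfY (fpsY q * F) m).
Proof.
move=> N; pose p := absz N; exists (absz m + p).+1 => n mn.
(* Modulo [pi^N] the first [p] terms of each expansion suffice, which leaves a finite double sum. As
   [n] exceeds [m + k] for all [k < p], it contains every term of the product. *)
pose a := \sum_(i < n) \sum_(k < p) cfY_term F (m - i%:Z) k * (q i : K).
have -> : cfY (fpsY q * F) m = cfY (fpsY q * F) m - a + a by rewrite subrK.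
rewrite opprD addrCA addrA [- (_ - a)]opprB -addrA [_ - a]addrC addrC.
apply: vgeD.
  rewrite /a addrC -sumrB; apply: vge_sum => i _; rewrite -mulr_suml -mulrBl.
  apply/vgeMl/vge_sums_to_tail; first exact: cfYP.
  by move=> k pk; apply: vge_cfY_term; lia.
suff -> : a = \sum_(k < p) cfY_term (fpsY q * F) m k.
  rewrite vgeBC; apply/vge_sums_to_tail; first exact: cfYP.
  by move=> k pk; apply: vge_cfY_term; lia.
rewrite /a exchange_big; apply: eq_bigr => k _.
have kp := ltn_ord k; rewrite /cfY_term; case: ifP => mk; last first.
  by rewrite big1 // => i _; rewrite ifF ?mul0r //; lia.
rewrite fpsY_mulE vring_val_sum mulr_suml.
have bn : ((absz (m + k%:Z)%R).+1 <= n)%N by lia.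
rewrite (sum_ord_cat (fun i : nat => (if 0 <= m - i%:Z + k%:Z then
  vring_val (F (absz (m - i%:Z + k%:Z)) k) * vring_val pi ^+ (e * k) else 0)
  * vring_val (q i)) bn).
rewrite [X in _ + X]big1 ?addr0 => [|i _]; last by rewrite ifF ?mul0r //; lia.
apply: eq_bigr => i _; have := ltn_ord i => ib; rewrite ifT; last by lia.
rewrite vring_valM mulrAC; congr (vring_val (F _ _) * _ * _); lia.
Qed.

Lemma cfX_mul F (p : fps R) (m : int) :
  sums_to ord (fun i => cfX F (m - i%:Z) * (p i : K)) (cfX (fpsX p * F) m).
Proof. by rewrite fpsX_swap; apply: cfY_mul. Qed.

(** The quotient must satisfy [G (j-1) (i-1) - pi^e G j i = F j i], and shifted diagonal sums do so
    by [diag_rec]. On the edges [i = 0] and [j = 0] the diagonal sums are, up to powers of [pi],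
    Laurent coefficients in [Y]; their vanishing closes the recursion. *)
Lemma cfY_eq0 F : (forall j, cfY F j = 0) ->
  exists G, (forall j i, vring_val (G j i) = diag F j.+1 i.+1) /\
    F = (fpsX (fps_var R) * fps_var (fps R) - fpsX (fps_const pi) ^+ e) * G.
Proof.
move=> F0.
have /choice[G GP] : forall j, exists Gj : fps R, forall i,
    vring_val (Gj i) = diag F j.+1 i.+1.
  move=> j; have /choice[g gP] : forall i, exists r : R,
      vring_val r = diag F j.+1 i.+1 by move=> i; apply/vringP/vge0_diag.
  by exists g.
exists G; split=> //; apply/funext => j; apply/funext => i.
rewrite laurent_relM; apply/val_inj; rewrite /= (GP j i).
have -> : vring_val (F j i) = diag F j i - (pi : K) ^+ e * diag F j.+1 i.+1.
  by rewrite diag_rec addrK.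
congr (_ - _); last by rewrite -vring_valX.
case: i => [|i].
  by rewrite -cfY_diag F0; case: j.
case: j => [|j]; last by rewrite GP.
have /eqP := F0 (- i.+1%:Z); rewrite cfYN mulf_eq0 => /orP[/eqP|].
  by rewrite cfX_diag.
by rewrite expf_eq0 (negbTE pi_neq0) andbF.
Qed.

End LaurentExpansion.

(** * Existence of the minimal valuation and of the extremal dominant indices *)

Section Indices.
Variables (K : fieldType) (ord : discrete_valuation K) (a : int -> K).
Local Notation vge N x := (N%R%:E <= ord x%R)%E.

(** Valuations in [nat] attain their minimum once one of them is finite, so [eta_of] does not take
    its default value. *)
Lemma eta_ofP : (forall i, vge 0 (a i)) -> (exists i, a i != 0) ->
  (exists i, ord (a i) = (eta_of ord a)%:E) /\
  (forall i, vge (eta_of ord a) (a i)).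
Proof.
move=> a_ge0 [i0 ai0].
have ordE i : a i != 0 -> exists n : nat, ord (a i) = n%:Z%:E.
  move=> ai; have [m mE] := ord_fin ord ai; exists (absz m).
  by have := a_ge0 i; rewrite mE lee_fin => m0; congr EFin; lia.
have exn : exists n : nat, `[< exists i, ord (a i) = n%:Z%:E >].
  by have [n nE] := ordE _ ai0; exists n; apply/asboolP; exists i0.
have [n /asboolP[i nE] nmin] := ex_minnP exn.
apply: (@xgetPex _ 0 [set m : int | (exists i, ord (a i) = m%:E) /\
                                    forall i, vge m (a i)]%classic).
exists n%:Z; split; first by exists i.
move=> j; have [->|aj] := eqVneq (a j) 0; first exact: vge0.
have [m mE] := ordE _ aj; rewrite mE lee_fin lez_nat.
by apply: nmin; apply/asboolP; exists j.
Qed.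

Hypothesis a_eta : exists i, ord (a i) = (eta_of ord a)%:E.

Lemma min_indexP : nullseq ord (fun i => a (- i%:Z)) ->
  ord (a (min_index ord a)) = (eta_of ord a)%:E /\
  (forall j, ord (a j) = (eta_of ord a)%:E -> min_index ord a <= j).
Proof.
move=> /(_ (eta_of ord a + 1))[n0 n0P].
(* At indices at most [- n0] the valuation exceeds the minimum; a shift by [n0] makes the search for
   the least index one over [nat]. *)
have lbd j : ord (a j) = (eta_of ord a)%:E -> - n0%:Z < j.
  move=> aj; rewrite ltNge; apply/negP => jn.
  have /n0P : (n0 <= absz j)%N by lia.
  by rewrite (_ : - (absz j)%:Z = j) ?(ord_ltF aj) //; lia.
have exn : exists n : nat,
    `[< ord (a (n%:Z - n0%:Z)) = (eta_of ord a)%:E >].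
  have [i iE] := a_eta; exists (absz (i + n0%:Z)%R); apply/asboolP.
  by rewrite -iE; congr (ord (a _)); have := lbd _ iE; lia.
have [n /asboolP nE nmin] := ex_minnP exn.
apply: (@xgetPex _ 0 [set i : int | ord (a i) = (eta_of ord a)%:E /\
  forall j, ord (a j) = (eta_of ord a)%:E -> i <= j]%classic).
exists (n%:Z - n0%:Z); split=> // j jE; have jn := lbd _ jE.
have : (n <= absz (j + n0%:Z)%R)%N; last by lia.
apply: nmin; apply/asboolP; rewrite -jE; congr (ord (a _)); lia.
Qed.

Lemma max_indexP : nullseq ord (fun i => a i%:Z) ->
  ord (a (max_index ord a)) = (eta_of ord a)%:E /\
  (forall j, ord (a j) = (eta_of ord a)%:E -> j <= max_index ord a).
Proof.
move=> /(_ (eta_of ord a + 1))[n0 n0P].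
have ubd j : ord (a j) = (eta_of ord a)%:E -> j < n0%:Z.
  move=> aj; rewrite ltNge; apply/negP => jn.
  have /n0P : (n0 <= absz j)%N by lia.
  by rewrite (_ : (absz j)%:Z = j) ?(ord_ltF aj) //; lia.
have exn : exists n : nat,
    `[< ord (a (n0%:Z - n%:Z)) = (eta_of ord a)%:E >].
  have [i iE] := a_eta; exists (absz (n0%:Z - i)%R); apply/asboolP.
  by rewrite -iE; congr (ord (a _)); have := ubd _ iE; lia.
have [n /asboolP nE nmin] := ex_minnP exn.
apply: (@xgetPex _ 0 [set i : int | ord (a i) = (eta_of ord a)%:E /\
  forall j, ord (a j) = (eta_of ord a)%:E -> j <= i]%classic).
exists (n0%:Z - n%:Z); split=> // j jE; have jn := ubd _ jE.
have : (n <= absz (n0%:Z - j)%R)%N; last by lia.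
apply: nmin; apply/asboolP; rewrite -jE; congr (ord (a _)); lia.
Qed.

End Indices.

(** * Removal of all coefficients above a dominant index *)

Section Truncation.
Variables (K : fieldType) (ord : discrete_valuation K).
Hypothesis K_complete : ord_complete ord.
Local Notation R := (vring ord).
Local Notation vge N x := (N%R%:E <= ord x%R)%E.

(* The sum is the coefficient of [T^n] in [x * sum_i a i T^i]. *)
Lemma clear_upper (a : int -> K) (m r : int) (b : bool) :
  (forall i, vge m (a i)) -> ord (a r) = m%:E ->
  nullseq ord (fun i => a (- i%:Z)) ->
  (if b then (forall i, r < i -> vge (m + 1) (a i)) /\
             nullseq ord (fun i => a i%:Z)
   else forall i, i < r -> vge (m + 1) (a i)) ->
  exists x y : fps R, [/\ x 0%N = 1, x * y = 1,
    forall n : int, r < n ->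
      sums_to ord (fun i => a (n - i%:Z) * (x i : K)) 0
    & b -> [/\ forall i, (0 < i)%N -> vge 1 (x i),
               nullseq ord (fun i => x i) & nullseq ord (fun i => y i)]].
Proof.
move=> am ar anull ab.
have ar0 := ord_neq0 ar.
have vge_quot N i : vge (m + N) (a i) -> vge N (a i / a r).
  by move=> h; have := vge_div ar h; apply: vgeW; lia.
(* Shifting by [r] and dividing by [a r] gives [D 0 = 1] and turns the dominance hypotheses into
   those of [toeplitz]. *)
have /choice[D DE] : forall i, exists d : R, vring_val d = a (r + i) / a r.
  by move=> i; apply: vringP; apply: vge_quot; rewrite addr0.
have D0 : D 0 = 1.
  by apply: val_inj; rewrite /= DE addr0 divff.
have Dnull : nullseq ord (fun i => D (- i%:Z)).
  move=> N; have [n0 h] := anull (m + N); exists (n0 + absz r)%N => n rn.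
  rewrite DE; apply: vge_quot.
  have -> : r - n%:Z = - (absz (n%:Z - r)%R)%:Z by lia.
  by apply: h; lia.
have Db : if b then (forall i : nat, (0 < i)%N -> vge 1 (D i%:Z)) /\
      nullseq ord (fun i => D i%:Z)
    else forall i : nat, (0 < i)%N -> vge 1 (D (- i%:Z)).
  case: b ab => [[ab anull']|ab].
    split=> [i i0|N]; first by rewrite DE; apply/vge_quot/ab; lia.
    have [n0 h] := anull' (m + N); exists (n0 + absz r)%N => n rn.
    rewrite DE; apply: vge_quot.
    have -> : r + n%:Z = (absz (n%:Z + r)%R)%:Z by lia.
    by apply: h; lia.
  by move=> i i0; rewrite DE; apply/vge_quot/ab; lia.
have [x [x0 xD xb]] := toeplitz K_complete D0 Dnull Db.
have [y xy] := @fps_unit R x x0; exists x, y; split=> //.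
  (* Index [n] of the product is row [n - r > 0] of the system, rescaled by [a r]. *)
  move=> n rn; have n0 : (0 < absz (n - r)%R)%N by lia.
  have := convergesZ (a r) (xD _ n0); rewrite mulr0.
  apply: (@converges_eventually _ _ _ _ _ 0%N) => k _.
  rewrite /toep mulr_sumr; apply: eq_bigr => i _.
  rewrite DE mulrA mulrCA divff // mulr1; congr (a _ * _); lia.
move=> /xb[x1 xnull]; split=> //; exact: fps_inv_null xy x1 x0 xnull.
Qed.

End Truncation.

(** * Convergence conditions and the factorization for power series *)

Section Factorization.
Variables (K : fieldType) (ord : discrete_valuation K).
Hypothesis K_complete : ord_complete ord.
Local Notation R := (vring ord).
Local Notation vge N x := (N%R%:E <= ord x%R)%E.
Variables (pi : R) (e : nat).
Hypothesis pi_uniformizer : ord pi = (1 : int)%:E.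
Hypothesis e_ge1 : (0 < e)%N.
Implicit Types F G : fps (fps R).
Local Notation cfY := (cfY pi e).
Local Notation cfX := (cfX pi e).

Lemma nullseq_cfY_neg F : nullseq ord (fun i => cfY F (- i%:Z)).
Proof.
move=> N; exists (absz N) => i Ni; rewrite cfYN // mulrC -[N]addr0.
by apply: vgeM; [apply: vge_pi_exp => //; lia | apply: vge0_cfY].
Qed.

Lemma nullseq_cfX_neg F : nullseq ord (fun i => cfX F (- i%:Z)).
Proof. exact: nullseq_cfY_neg. Qed.

Lemma closed_semiopen F :
  series_cond ClosedAnnulus F -> series_cond SemiOpenAnnulus F.
Proof.
move=> cF j N; have [n0 h] := cF N; exists n0 => i n0i; apply: h.
exact: leq_trans (leq_addr _ _).
Qed.

(** Series in [R{X}[[Y]]] are controlled row by row only, but a diagonal sum modulo [pi^N] meets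
    finitely many rows, which admit a common bound. *)
Lemma semiopen_unif F j p (N : int) : series_cond SemiOpenAnnulus F ->
  exists n0 : nat, forall i n : nat, (n0 <= i)%N -> (n < p)%N ->
    vge N (F (j + n)%N i).
Proof.
move=> cF; elim: p => [|p [n0 h]]; first by exists 0%N.
have [n1 h1] := cF (j + p)%N N; exists (maxn n0 n1) => i n.
rewrite geq_max => /andP[n0i n1i]; rewrite ltnS leq_eqVlt => /orP[/eqP->|np].
  exact: h1.
exact: h.
Qed.

Lemma nullseq_cfX F :
  series_cond SemiOpenAnnulus F -> nullseq ord (fun i => cfX F i%:Z).
Proof.
move=> cF N; have [n0 h] := semiopen_unif 0 (absz N) N cF.
exists n0 => i n0i; rewrite cfX_diag //; apply: vge_diag => // n nN.
by apply: h => //; apply: leq_trans (leq_addr _ _).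
Qed.

Lemma nullseq_cfY F :
  series_cond ClosedAnnulus F -> nullseq ord (fun i => cfY F i%:Z).
Proof.
move=> cF N; have [n0 h] := cF N.
exists n0 => j n0j; rewrite cfY_diag //; apply: vge_diag => // n nN.
by apply: h; lia.
Qed.

(** This puts the quotient found in [cfY_eq0] back into [series k], so that divisibility by
    [XY - pi^e] holds in that ring. *)
Lemma series_cond_diag k F G : series_cond k F ->
  (forall j i, vring_val (G j i) = diag pi e F j.+1 i.+1) -> series_cond k G.
Proof.
case: k => //= cF GF => [j N|N].
  have [n0 h] := semiopen_unif j.+1 (absz N) N cF.
  exists n0 => i n0i; rewrite GF; apply: vge_diag => // n nN.
  by apply: h => //; lia.
have [n0 h] := cF N; exists n0 => i j n0ij; rewrite GF.
by apply: vge_diag => // n nN; apply: h; lia.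
Qed.

(* Which one-variable series converge: null sequences in X unless V is open,
   null sequences in Y if V is closed. *)
Definition nullX k := if k is OpenAnnulus then false else true.
Definition nullY k := if k is ClosedAnnulus then true else false.

Lemma fpsX_series k (p : fps R) :
  (nullX k -> nullseq ord (fun i => p i)) -> fpsX p \in series_pred k.
Proof.
case: k => /= pnull; apply/asboolP => //=.
  move=> [|j] N; last by exists 0%N => i _; rewrite vge0.
  by have [n0 h] := pnull isT N; exists n0 => i /h.
move=> N; have [n0 h] := pnull isT N; exists n0 => i [|j]; last first.
  by move=> _; rewrite vge0.
by rewrite addn0 => /h.
Qed.

Lemma fpsY_series k (q : fps R) :
  (nullY k -> nullseq ord (fun j => q j)) -> fpsY q \in series_pred k.
Proof.
case: k => /= qnull; apply/asboolP => //=.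
  by move=> j N; exists 1%N => -[//|i] _; rewrite vge0.
move=> N; have [n0 h] := qnull isT N; exists n0 => -[|i] j; last first.
  by move=> _; rewrite vge0.
by rewrite add0n => /h.
Qed.

Lemma fpsY_var : fpsY (fps_var R) = fps_var (fps R).
Proof. by apply/funext => -[|[|j]]; apply/funext => -[|i]. Qed.

Lemma fpsY_const (r : R) : fpsY (fps_const r) = fpsX (fps_const r).
Proof. by apply/funext => -[|j]; apply/funext => -[|i]. Qed.

Lemma sums_to_eventually (s : nat -> K) n0 :
  (forall n, (n0 <= n)%N -> s n = 0) -> sums_to ord s (\sum_(k < n0) s k).
Proof.
move=> s0 N; exists n0 => n n0n; rewrite (sum_ord_cat s n0n) addrC addKr.
by rewrite big1 ?vge0 // => i _; rewrite s0 // leq_addr.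
Qed.

Lemma cfY_varM F j : cfY (fps_var (fps R) * F) j = cfY F (j - 1).
Proof.
rewrite -fpsY_var.
have h := cfY_mul K_complete pi_uniformizer e_ge1 F (fps_var R) j.
apply: sums_to_uniq h _.
have -> : cfY F (j - 1) =
    \sum_(k < 2) cfY F (j - k%:Z) * vring_val (fps_var R k).
  by rewrite !big_ord_recr big_ord0 /fps_var /= mulr0 mulr1 !add0r.
by apply: sums_to_eventually => -[|[|n]] // _; rewrite /fps_var mulr0.
Qed.

Lemma cfY_varXM F a j : cfY (fps_var (fps R) ^+ a * F) j = cfY F (j - a%:Z).
Proof.
elim: a j => [|a IHa] j; first by rewrite mul1r subr0.
rewrite exprS -mulrA cfY_varM IHa; congr (cfY F _); lia.
Qed.

Lemma cfY_constM F (r : R) j :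
  cfY (fpsX (fps_const r) * F) j = (r : K) * cfY F j.
Proof.
rewrite -fpsY_const.
have h := cfY_mul K_complete pi_uniformizer e_ge1 F (fps_const r) j.
apply: sums_to_uniq h _.
have -> : (r : K) * cfY F j =
    \sum_(k < 1) cfY F (j - k%:Z) * vring_val (fps_const r k).
  by rewrite big_ord1 subr0 mulrC.
by apply: sums_to_eventually => -[|n] // _; rewrite /fps_const mulr0.
Qed.

Lemma cfY_constXM F (r : R) n j :
  cfY (fpsX (fps_const r) ^+ n * F) j = (r : K) ^+ n * cfY F j.
Proof.
elim: n => [|n IHn]; first by rewrite !mul1r.
by rewrite !exprS -!mulrA cfY_constM IHn.
Qed.

(* As [X = pi ^ e / Y], only the constant term of [x] matters modulo
   [pi ^ (m + 1)]. *)
Lemma cfY_fpsXM F (x : fps R) (m : int) :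
  (forall j, vge m (cfY F j)) -> x 0%N = 1 ->
  forall j, vge (m + 1) (cfY (fpsX x * F) j - cfY F j).
Proof.
move=> Fm x0 j; have pi0 := pi_neq0 pi_uniformizer.
have h := sums_toZ ((pi : K) ^ (- (e%:Z * j)))
  (cfX_mul K_complete pi_uniformizer e_ge1 F x (- j)).
move: h; rewrite [_ * cfX _ _]mulrC -cfX_cfY // => h.
have tE i : (pi : K) ^ (- (e%:Z * j)) * (cfX F (- j - i%:Z) * (x i : K)) =
    cfY F (j + i%:Z) * ((pi : K) ^+ (e * i) * (x i : K)).
  rewrite [in RHS]cfX_cfY // opprD -[(pi : K) ^+ _]/((pi : K) ^ (e * i)%N%:Z).
  have -> : - (e%:Z * j) = - (e%:Z * (j + i%:Z)) + (e * i)%N%:Z.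
    by rewrite PoszM; ring.
  by rewrite expfzDr //; ring.
have := vge_sums_to_tail (N := m + 1) (p := 1) h.
rewrite big_ord1 tE addr0 muln0 x0 mul1r mulr1; apply => n n0.
by rewrite tE; apply: vgeM => //; apply/vgeMl/vge_pi_exp.
Qed.

(** The factors come with inverses in the same ring of series, so that they become units of [A];
    [lam] is the unit part of the top coefficient. *)
Lemma laurent_factorization k F (alpha beta : int) (eta : nat) :
  series_cond k F ->
  (forall j, vge eta%:Z (cfY F j)) ->
  (exists m, [/\ forall i, vge m (cfX F i), ord (cfX F alpha) = m%:E
    & if nullX k then forall i, alpha < i -> vge (m + 1) (cfX F i)
      else forall i, i < alpha -> vge (m + 1) (cfX F i)]) ->
  ord (cfY F beta) = eta%:Z%:E ->
  (if nullY k then forall j, beta < j -> vge (eta%:Z + 1) (cfY F j)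
   else forall j, j < beta -> vge (eta%:Z + 1) (cfY F j)) ->
  exists (x x' y y' : fps R) (P : {poly R}) (lam lam' : R),
    [/\ [/\ x * x' = 1, y * y' = 1 & lam * lam' = 1],
        [/\ fpsX x \in series_pred k, fpsX x' \in series_pred k,
            fpsY y \in series_pred k & fpsY y' \in series_pred k],
        P \is monic
      & forall j, cfY (fpsY y * (fpsX x * F)) (j - alpha) =
          (lam : K) * (pi : K) ^+ eta *
          (if 0 <= j then vring_val P`_(absz j) else 0)].
Proof.
move=> cF etaF [m [mF malpha mb]] etabeta etab.
have pi0 := pi_neq0 pi_uniformizer.
have [|x [x' [x0 xx' xa xb]]] := @clear_upper _ _ K_complete (cfX F) m alpha
    (nullX k) mF malpha (nullseq_cfX_neg F).
  by case: (k) cF mb => //= cF mb; split=> //; apply: nullseq_cfX => //;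
    apply: closed_semiopen.
have xS : fpsX x \in series_pred k by apply: fpsX_series => /xb[].
have x'S : fpsX x' \in series_pred k by apply: fpsX_series => /xb[].
pose F1 := fpsX x * F.
have cF1 : series_cond k F1.
  by apply/asboolP/(rpredM xS)/asboolP.
have F1F := cfY_fpsXM etaF x0.
(* Powers of [X] above [alpha] are powers of [Y] below [- alpha]. *)
have F1alpha j : j < - alpha -> cfY F1 j = 0.
  move=> ja; rewrite cfX_cfY // (_ : cfX F1 (- j) = 0) ?mul0r //.
  apply: sums_to_uniq (cfX_mul K_complete pi_uniformizer e_ge1 F x (- j)) _.
  by apply: xa; lia.
have etaF1 j : vge eta%:Z (cfY F1 j).
  rewrite -[cfY F1 j](subrK (cfY F j)); apply: vgeD => //.
  by apply: vgeW (F1F j); lia.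
have beta1 : ord (cfY F1 beta) = eta%:Z%:E := ord_addl etabeta (F1F beta).
have etab1 j : vge (eta%:Z + 1) (cfY F j) -> vge (eta%:Z + 1) (cfY F1 j).
  by move=> h; rewrite -[cfY F1 j](subrK (cfY F j)); apply: vgeD.
have [|y [y' [y0 yy' ya yb]]] := @clear_upper _ _ K_complete (cfY F1) eta%:Z
    beta (nullY k) etaF1 beta1 (nullseq_cfY_neg F1).
  case: (k) cF1 etab => //= cF1 etab; try by move=> j /etab /etab1.
  by split; [move=> j /etab /etab1 | apply: nullseq_cfY].
have yS : fpsY y \in series_pred k by apply: fpsY_series => /yb[].
have y'S : fpsY y' \in series_pred k by apply: fpsY_series => /yb[].
pose F2 := fpsY y * F1.
have F2sum j := cfY_mul K_complete pi_uniformizer e_ge1 F1 y j.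
have F2alpha j : j < - alpha -> cfY F2 j = 0.
  move=> ja; apply: sums_to_uniq (F2sum j) _; apply: sums_to0 => n.
  by rewrite F1alpha ?mul0r //; lia.
have F2beta j : beta < j -> cfY F2 j = 0.
  by move=> bj; apply: sums_to_uniq (F2sum j) (ya _ bj).
have etaF2 j : vge eta%:Z (cfY F2 j).
  by apply: vge_sums_to (F2sum j) _ => n; apply: vgeMl.
(* The terms [i > 0] of the convolution are negligible at [beta]: if [V] is not closed they involve
   coefficients below [beta], which are not dominant; if [V] is closed, [y i] has positive
   valuation. *)
have beta2 : ord (cfY F2 beta) = eta%:Z%:E.
  apply: (ord_addl beta1); have := vge_sums_to_tail (N := eta%:Z + 1) (p := 1)
    (F2sum beta).
  rewrite big_ord1 subr0 y0 mulr1; apply => n n0.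
  case: (k) etab yb => /= etab yb.
  - by apply/vgeMl/etab1/etab; lia.
  - by apply/vgeMl/etab1/etab; lia.
  - by apply: vgeM => //; have [h _ _] := yb isT; apply: h.
pose mu := cfY F2 beta.
have mu0 : mu != 0 := ord_neq0 beta2.
have pieta := ord_pi_exp pi_uniformizer eta.
have [lam lamE] : exists r : R, vring_val r = mu / (pi : K) ^+ eta.
  by apply: vringP; have := vge_div pieta (etaF2 beta); rewrite subrr.
have [lam' lamE'] : exists r : R, vring_val r = (pi : K) ^+ eta / mu.
  apply: vringP; have : vge eta%:Z ((pi : K) ^+ eta) by rewrite pieta.
  by move=> /(vge_div beta2); rewrite subrr.
have /choice[p pE] : forall l : nat, exists r : R,
    vring_val r = cfY F2 (l%:Z - alpha) / mu.
  move=> l; apply: vringP.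
  by have := vge_div beta2 (etaF2 (l%:Z - alpha)); rewrite subrr.
(* The nonzero coefficient at [beta] cannot lie in the cleared range, so [alpha + beta] is
   nonnegative and can serve as the degree of [P]. *)
have ab : - alpha <= beta.
  rewrite leNgt; apply/negP => /F2alpha mu_eq0.
  by rewrite /mu mu_eq0 eqxx in mu0.
pose N := absz (alpha + beta)%R.
pose P := \poly_(l < N.+1) p l.
have PE l : vring_val P`_l = cfY F2 (l%:Z - alpha) / mu.
  rewrite coef_poly; case: ltnP => lN; first by rewrite pE.
  by rewrite F2beta ?mul0r //; rewrite /N in lN; lia.
have PN : p N = 1.
  apply: val_inj; rewrite /= pE (_ : N%:Z - alpha = beta) ?divff //.
  by rewrite /N; lia.
exists x, x', y, y', P, lam, lam'; split=> //.
- split=> //; apply: val_inj; rewrite /= lamE lamE'.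
  by rewrite mulf_div [X in _ / X]mulrC divff // mulf_neq0 ?expf_neq0.
- by rewrite monicE lead_coef_poly ?PN // oner_neq0.
- move=> j; rewrite lamE divfK ?expf_neq0 //; case: ifP => j0; last first.
    by rewrite F2alpha ?mulr0 //; lia.
  by rewrite PE [RHS]mulrCA divff // mulr1; congr (cfY F2 _); lia.
Qed.

End Factorization.

Lemma fps_varXM (S : comNzRingType) (p : fps S) l n :
  (fps_var S ^+ l * p) n = if (l <= n)%N then p (n - l)%N else 0.
Proof.
elim: l n => [|l IHl] n; first by rewrite mul1r subn0.
by rewrite exprS -mulrA fps_varM; case: n => [|n] //; rewrite IHl.
Qed.

Lemma fps_constC (S : comNzRingType) (a b : S) :
  fps_const a * fps_const b = fps_const (a * b).
Proof.
apply/funext => n; rewrite fps_constM /fps_const.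
by case: n => //=; rewrite mulr0.
Qed.

(** * Images of polynomials and units under the presentation *)

Section Presentation.
Variables (K : fieldType) (ord : discrete_valuation K).
Local Notation R := (vring ord).
Variable k : annulus_kind.

Lemma series_valB (F G : series ord k) :
  series_val (F - G) = series_val F - series_val G.
Proof. by []. Qed.

Lemma series_valM (F G : series ord k) :
  series_val (F * G) = series_val F * series_val G.
Proof. exact: (rmorphM \val). Qed.

Lemma series_valX (F : series ord k) n :
  series_val (F ^+ n) = series_val F ^+ n.
Proof. exact: (rmorphXn \val). Qed.

Lemma poly_series (P : {poly R}) : fpsY (fun i => P`_i) \in series_pred k.
Proof.
apply: fpsY_series => _ N; exists (size P) => n Pn.
by rewrite nth_default // vge0.
Qed.

(** Finite support makes the series an algebraic expression in the generator [Y], so that [phi] acts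
    on it by evaluation. *)
Lemma poly_seriesE (P : {poly R}) : Series (poly_series P) =
  \sum_(i < size P) seriesC k P`_i * seriesY ord k ^+ i.
Proof.
have termE l (c : R) : series_val (seriesC k c * seriesY ord k ^+ l) =
    fps_var (fps R) ^+ l * fpsX (fps_const c).
  by rewrite series_valM series_valX mulrC.
apply/val_inj; rewrite raddf_sum; apply/funext => j; apply/funext => i.
rewrite !fps_sumE [LHS]/=.
rewrite (eq_bigr (fun l : 'I_(size P) =>
  (fps_var (fps R) ^+ l * fpsX (fps_const P`_l)) j i)); last first.
  by move=> l _; rewrite -termE.
under eq_bigr => l _ do rewrite fps_varXM.
rewrite fpsYE; case: i => [|i]; last first.
  by rewrite big1 // => l _; case: ifP => // _; case: (j - l)%N.
have coefE l : (if (l <= j)%N then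
    (fpsX (fps_const P`_l) : fps (fps R)) (j - l)%N else 0) 0%N =
    if (l == j) then P`_l else 0.
  case: ltngtP => // [lj|->]; last by rewrite subnn.
  by rewrite -(subnSK lj).
have [Pj|jP] := leqP (size P) j.
  rewrite nth_default // big1 // => l _; rewrite coefE ifF //.
  by have := ltn_ord l; lia.
rewrite (bigD1 (Ordinal jP)) //= coefE eqxx big1 ?addr0 // => l lj.
by rewrite coefE ifN.
Qed.

Variables (A : comUnitRingType) (phi : {rmorphism series ord k -> A}).

Lemma phi_poly (P : {poly R}) : phi (Series (poly_series P)) =
  (map_poly (fun r => phi (seriesC k r)) P).[phi (seriesY ord k)].
Proof.
rewrite poly_seriesE rmorph_sum /map_poly horner_poly.
by apply: eq_bigr => i _; rewrite rmorphM rmorphXn.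
Qed.

Lemma unit_phi (F G : series ord k) : F * G = 1 -> phi F \is a GRing.unit.
Proof.
move=> FG; apply/unitrP; exists (phi G).
by rewrite -!rmorphM [G * F]mulrC FG rmorph1.
Qed.

End Presentation.

(** * Passage from power series to functions on the annulus *)

Theorem proposition6p5
    (K : fieldType) (ord : discrete_valuation K) (K_complete : ord_complete ord)
    (pi : vring ord) (pi_uniformizer : ord (vring_val pi) = (1 : int)%:E)
    (k : annulus_kind) (e : nat) (e_ge1 : (1 <= e)%N)
    (* A is the ring of functions on the annulus bounded by 1 *)
    (A : comUnitRingType) (phi : {rmorphism series ord k -> A})
    (phi_presentation : is_presentation pi e phi)
    (* B = A[1/pi] is the ring of bounded functions, in which Y is invertible *)
    (B : comUnitRingType) (iota : {rmorphism A -> B})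
    (iota_localization : is_localization_away iota (phi (seriesC k pi)))
    (f : A) (f_neq0 : f != 0) :
  let Y : A := phi (seriesY ord k) in
  let c : vring ord -> A := fun r => phi (seriesC k r) in
  exists (P : {poly vring ord}) (u : A),
    [/\ P \is monic,
        u \is a GRing.unit
      & iota Y ^ alpha_X pi e phi f * iota f =
        iota (c pi) ^ eta_Y pi e phi f * iota (map_poly c P).[Y] * iota u].
Proof.
move=> Y c; have [phi_surj phi_eq0] := phi_presentation.
pose S := lift_of phi f; pose F := series_val S.
have phiS : phi S = f by apply: xgetPex (phi_surj f).
have cF : series_cond k F by apply/asboolP/(valP S).
(* Identities in [A] can thus be checked on the Y-expansions of lifts. *)
have ker (H : series ord k) :
    (forall j, cfY pi e (series_val H) j = 0) -> phi H = 0.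
  move=> H0; have [G [GE HE]] := cfY_eq0 K_complete pi_uniformizer e_ge1 H0.
  have GS : G \in series_pred k.
    apply/asboolP/(series_cond_diag K_complete pi_uniformizer e_ge1 _ GE).
    exact/asboolP/(valP H).
  apply/phi_eq0; exists (Series GS); apply/val_inj; rewrite [LHS]HE.
  by rewrite [RHS]series_valM series_valB series_valM series_valX.
pose a := laurentX pi e phi f; pose b := laurentY pi e phi f.
have aE i : a i = cfX pi e F i by [].
have bE j : b j = cfY pi e F j by [].
have [j0 bj0] : exists j, b j != 0.
  apply: contrapT => b0; move/eqP: f_neq0; apply.
  rewrite -phiS; apply: ker => j.
  by apply/eqP/negPn/negP => bj; apply: b0; exists j.
have ai0 : a (- j0) != 0.
  apply: contraNneq bj0 => a0.
  by rewrite bE cfX_cfY // -aE a0 mul0r.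
have a_ge0 i : (0%:E <= ord (a i))%E.
  by rewrite ?aE ?bE; apply: vge0_cfY.
have b_ge0 j : (0%:E <= ord (b j))%E.
  by rewrite ?aE ?bE; apply: vge0_cfY.
have [a_att a_min] := eta_ofP a_ge0 (ex_intro (fun i => a i != 0) _ ai0).
have [b_att b_min] := eta_ofP b_ge0 (ex_intro (fun j => b j != 0) _ bj0).
have a_null := nullseq_cfX_neg K_complete pi_uniformizer e_ge1 F.
have b_null := nullseq_cfY_neg K_complete pi_uniformizer e_ge1 F.
have [h hE] : exists h : nat, eta_of ord b = h%:Z.
  exists (absz (eta_of ord b)); have [j jE] := b_att.
  by have := b_ge0 j; rewrite jE lee_fin; lia.
have notmin (s : int -> K) m j : (forall i, (m%:E <= ord (s i))%E) ->
    ord (s j) <> m%:E -> ((m + 1)%:E <= ord (s j))%E.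
  by move=> sm /eqP; apply: ord_gtP.
pose alpha := alpha_X pi e phi f.
have alphaP : exists m, [/\ forall i, (m%:E <= ord (cfX pi e F i))%E,
    ord (cfX pi e F alpha) = m%:E
  & if nullX k then forall i, alpha < i -> ((m + 1)%:E <= ord (cfX pi e F i))%E
    else forall i, i < alpha -> ((m + 1)%:E <= ord (cfX pi e F i))%E].
  exists (eta_of ord a).
  have maxP : series_cond SemiOpenAnnulus F -> [/\ forall i,
      ((eta_of ord a)%:E <= ord (a i))%E,
      ord (a (max_index ord a)) = (eta_of ord a)%:E
      & forall i, max_index ord a < i ->
        ((eta_of ord a + 1)%:E <= ord (a i))%E].
    move=> cS; have an := nullseq_cfX K_complete pi_uniformizer e_ge1 cS.
    have [mE mmax] := max_indexP a_att an; split=> // i mi.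
    by apply: notmin => // /mmax; rewrite leNgt mi.
  have -> : alpha =
    if k is OpenAnnulus then min_index ord a else max_index ord a by [].
  move: cF maxP; case: (k) => cF maxP.
  - have [mE mmin] := min_indexP a_att a_null; split=> // i mi.
    by apply: notmin => // /mmin; rewrite leNgt mi.
  - exact: maxP.
  - exact/maxP/closed_semiopen.
(* [beta] is the first dominant index of the Y-expansion, or the last one if [V] is closed, where
   coefficients of high powers of [Y] also tend to 0. *)
have [beta [betaE betaP]] : exists beta, ord (cfY pi e F beta) = h%:Z%:E /\
    if nullY k
    then forall j, beta < j -> ((h%:Z + 1)%:E <= ord (cfY pi e F j))%E
    else forall j, j < beta -> ((h%:Z + 1)%:E <= ord (cfY pi e F j))%E.
  rewrite -hE; have [mE mmin] := min_indexP b_att b_null.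
  have minP : ord (b (min_index ord b)) = (eta_of ord b)%:E /\
      forall j, j < min_index ord b ->
        ((eta_of ord b + 1)%:E <= ord (b j))%E.
    by split=> // j mj; apply: notmin => // /mmin; rewrite leNgt mj.
  case: (k) cF => cF; [by exists (min_index ord b)..|].
  have bn := nullseq_cfY K_complete pi_uniformizer e_ge1 cF.
  have [ME Mmax] := max_indexP b_att bn.
  exists (max_index ord b); split=> // j Mj.
  by apply: notmin => // /Mmax; rewrite leNgt Mj.
have Fh j : (h%:Z%:E <= ord (cfY pi e F j))%E by rewrite -hE; apply: b_min.
have [x [x' [y [y' [P [lam [lam' [[xx' yy' ll'] [xS x'S yS y'S] Pm PE]]]]]]]] :=
  laurent_factorization K_complete pi_uniformizer e_ge1 cF Fh alphaP
    betaE betaP.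
(* As [alpha] may be negative, it is split into natural exponents on the two sides; the identity is
   then proved in [A] before inverting [Y]. *)
have [a1 [a2 a12]] : exists a1 a2 : nat, alpha = a1%:Z - a2%:Z.
  by case: alpha {alphaP PE} => n;
    [exists n, 0%N; rewrite subr0 | exists 0%N, n.+1; rewrite NegzE sub0r].
pose X1 := Series xS; pose X2 := Series x'S.
pose Y1 := Series yS; pose Y2 := Series y'S.
have X12 : X1 * X2 = 1 by apply/val_inj; rewrite [LHS]series_valM -fpsXM xx'.
have Y12 : Y1 * Y2 = 1.
  by apply/val_inj; rewrite [LHS]series_valM -fpsYM yy' fpsY1.
have L12 : seriesC k lam * seriesC k lam' = 1.
  by apply/val_inj; rewrite [LHS]series_valM -[LHS]fpsXM fps_constC ll'.
have key : phi (seriesY ord k ^+ a1 * (Y1 * (X1 * S))) =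
    phi (seriesY ord k ^+ a2 *
    (seriesC k lam * (seriesC k pi ^+ h * Series (poly_series k P)))).
  apply/eqP; rewrite -subr_eq0 -rmorphB; apply/eqP/ker => j.
  rewrite series_valB !series_valM !series_valX cfYB // !cfY_varXM //.
  have -> : j - a1%:Z = j - a2%:Z - alpha by rewrite a12; ring.
  rewrite PE cfY_constM // cfY_constXM // cfY_fpsY mulrA.
  exact: subrr.
exists P, (phi (seriesC k lam * (X2 * Y2))); split=> //.
  rewrite !rmorphM !unitrM.
  rewrite (unit_phi phi L12) (@unit_phi _ _ _ _ phi X2 X1) 1?mulrC //.
  by rewrite (@unit_phi _ _ _ _ phi Y2 Y1) 1?mulrC.
have key' : Y ^+ a1 * f = Y ^+ a2 * (c pi ^+ h * (map_poly c P).[Y] *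
    phi (seriesC k lam * (X2 * Y2))).
  rewrite -phi_poly -phiS /Y /c -!rmorphXn -!rmorphM.
  have -> : seriesY ord k ^+ a1 * S =
      (X1 * X2) * (Y1 * Y2) * (seriesY ord k ^+ a1 * S).
    by rewrite X12 Y12 !mul1r.
  have -> : X1 * X2 * (Y1 * Y2) * (seriesY ord k ^+ a1 * S) =
      X2 * Y2 * (seriesY ord k ^+ a1 * (Y1 * (X1 * S))) by ring.
  rewrite [LHS]rmorphM key -rmorphM; congr (phi _); ring.
have [pi_unit _ _] := iota_localization.
(* [XY = pi^e], and [pi] is invertible in [B]. *)
have Y_unit : iota Y \is a GRing.unit.
  have XY : phi (seriesX ord k) * Y = c pi ^+ e.
    apply/eqP; rewrite -subr_eq0 -rmorphM -rmorphXn -rmorphB; apply/eqP/phi_eq0.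
    by exists 1; rewrite mulr1.
  have : iota (phi (seriesX ord k) * Y) \is a GRing.unit.
    by rewrite XY rmorphXn unitrX.
  by rewrite rmorphM unitrM => /andP[].
have keyB := congr1 iota key'.
rewrite -/alpha (_ : eta_Y pi e phi f = h%:Z) // a12 exprzDr // [LHS]mulrAC.
rewrite -[iota Y ^ a1]/(iota Y ^+ a1) -(rmorphXn iota) -[_ * iota f]rmorphM.
rewrite keyB !rmorphM !rmorphXn -exprnN [LHS]mulrAC divrr ?unitrX //.
by rewrite mul1r.
Qed.
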